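(* Let $N\ge1$ and let $f:\mathbb{R}^2\to\mathbb{R}$ be a nonnegative function taking, apart from the value $0$, only $N$ different values $0<\alpha_1<\dots<\alpha_N$, and let the corresponding $N$ upper level sets $\{x\in\mathbb{R}^2: f(x)\ge\alpha_i\}$, $i=1,\dots,N$, be closed, convex, and bounded with positive Lebesgue measure. Then $$\frac{2}{\pi N}\,|f|_{\mathrm{TV}}\le\|Rf\|_{\mathrm{RTV}}.$$
   Context: The Radon transform in $\mathbb{R}^2$ is $Rf(\sigma,\theta)=\int_{x\cdot\theta=\sigma}f(x)\,dx$ (integration over lines), $(\sigma,\theta)\in\mathbb{R}\times S^1$. The total variation seminorm on $\mathbb{R}^n$ is $$|f|_{\mathrm{TV}}=\sup\left\{\int_{\mathbb{R}^n}f(x)\,\mathrm{div}\,\phi(x)\,dx:\ \phi\in[C_0^\infty(\mathbb{R}^n)]^n,\ |\phi(\cdot)|\le1\right\}.$$ For $g:\mathbb{R}\times S^{1}\to\mathbb{R}$, $\|g\|_{\mathrm{RTV}}=\sup_{\theta\in S^{1}}|g(\cdot,\theta)|_{\mathrm{TV}}$, where $|g(\cdot,\theta)|_{\mathrm{TV}}$ is the one-dimensional total variation with respect to $\sigma$. *)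

(* Defs.v *)
From HB Require Import structures.
From mathcomp Require Import all_boot all_order all_algebra.
From mathcomp Require Import all_classical all_reals all_analysis.

Set Implicit Arguments.
Unset Strict Implicit.
Unset Printing Implicit Defensive.

Import Order.TTheory GRing.Theory Num.Theory.
Import numFieldNormedType.Exports.

Local Open Scope classical_set_scope.
Local Open Scope ring_scope.

(** The plane is [R * R]: its topology and its bounded sets are the Euclidean
    ones, but the library norm [`|x|] is the maximum norm, whence [enorm]. *)
Definition enorm {R : realType} (x : R * R) : R :=
  Num.sqrt (x.1 ^+ 2 + x.2 ^+ 2).

Definition unit_circle {R : realType} : set (R * R) :=
  [set theta | enorm theta = 1].

Definition lebesgue2 {R : realType} :=
  (@lebesgue_measure R \x @lebesgue_measure R)%E.

Definition iter_derive {R : realType} {V : normedModType R}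
    (s : seq V) (f : V -> R) : V -> R :=
  foldr (fun v g => 'D_v g) f s.

(** [e] lists the canonical basis of [V]: the partial derivatives of every
    order exist and are continuous. *)
Definition smooth {R : realType} {V : normedModType R}
    (e : seq V) (f : V -> R) : Prop :=
  forall s : seq V, {subset s <= e} ->
    continuous (iter_derive s f) /\
    forall x v, v \in e -> derivable (iter_derive s f) x v.

(** [C_0^oo]: smooth with compact support. *)
Definition test_function {R : realType} {V : normedModType R}
    (e : seq V) (f : V -> R) : Prop :=
  smooth e f /\ compact (closure [set x | f x != 0]).

Definition basis1 (R : realType) : seq R := [:: 1].

Definition basis2 (R : realType) : seq (R * R) := [:: (1, 0); (0, 1)].

Definition divergence {R : realType} (phi : R * R -> R * R) (x : R * R) : R :=
  'D_(1, 0) (fst \o phi) x + 'D_(0, 1) (snd \o phi) x.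

(** The total variation on [R^n] for [n = 1] and [n = 2]; a field [phi] on the
    line is scalar, with divergence [phi'], and in the plane [|phi| <= 1] is
    Euclidean. *)
Definition TV1 {R : realType} (g : R -> R) : \bar R :=
  ereal_sup [set I | exists phi : R -> R,
    [/\ test_function (basis1 R) phi,
        forall x, `|phi x| <= 1 &
        I = (\int[lebesgue_measure]_x (g x * phi^`()%classic x)%:E)%E]].

Definition TV2 {R : realType} (f : R * R -> R) : \bar R :=
  ereal_sup [set I | exists phi : R * R -> R * R,
    [/\ test_function (basis2 R) (fst \o phi),
        test_function (basis2 R) (snd \o phi),
        forall x, enorm (phi x) <= 1 &
        I = (\int[lebesgue2]_x (f x * divergence phi x)%:E)%E]].

(** For [theta] on the unit circle, [t |-> sigma theta + t theta^perp] is an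
    arc-length parametrization of the line [x . theta = sigma].  An infinite
    line integral is sent to [0], so that the transform is real-valued. *)
Definition radon {R : realType} (f : R * R -> R) (sigma : R) (theta : R * R)
    : R :=
  \int[lebesgue_measure]_t
    f (sigma * theta.1 - t * theta.2, sigma * theta.2 + t * theta.1).

Definition RTV {R : realType} (g : R -> R * R -> R) : \bar R :=
  ereal_sup [set TV1 (g ^~ theta) | theta in unit_circle].

Definition upper_level {R : realType} (f : R * R -> R) (a : R) : set (R * R) :=
  [set x | a <= f x].

(* Main.v *)
Require Import Defs.
From HB Require Import structures.
From mathcomp Require Import all_boot all_order all_algebra.
From mathcomp Require Import all_classical all_reals all_analysis.
From mathcomp Require Import measurable_realfun ring lra zify.

Set Implicit Arguments.
Unset Strict Implicit.
Unset Printing Implicit Defensive.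

Import Order.TTheory GRing.Theory Num.Theory.
Import numFieldNormedType.Exports.

Local Open Scope classical_set_scope.
Local Open Scope ring_scope.

(** Let [K_k] be the level set of the [k]-th value [alpha_k], and [c_k] the
    difference between [alpha_k] and the preceding value (0 for the first one),
    so that [f] is the sum of the functions [c_k 1_{K_k}] and
    [0 <= c_k <= alpha_k] ([layer_cake]).  Both sides of the inequality are
    compared with the diameters of the [K_k]; write [r] for the right-hand side.

    The diameter of [K_k] is at most [r / (2 alpha_k)] ([RTV_radon_ge]).  Given
    [p] and [q] in [K_k], take [theta] orthogonal to [q - p].  As [K_k] has
    positive area, it has a third point [z] off the line [pq], and the triangle
    [pqz] shows that every line close to [pq], on the side of [z], meets [K_k] in
    a segment of length at least [(1 - e) |q - p|].  Hence
    [Rf(., theta) >= alpha_k (1 - e) |q - p|] on an interval.  A nonnegative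
    function that vanishes far away and is at least [m] on an interval has
    variation at least [2 m] ([TV1_ge]): test it against a field that rises from
    -1 to 1 on the interval and whose other variations take place where the
    function vanishes.

    For a convex [K] of diameter at most [D] and a field [phi] with [|phi| <= 1],
    the integral of [div phi] over [K] is at most [pi D]
    ([convex_divergence_bound]); this combines the divergence theorem with the
    fact that a convex set of diameter [D] has perimeter at most [pi D].  The
    proof never mentions the boundary of [K].  Let [theta_j] be the vertices of a
    regular [4l]-gon inscribed in the unit circle, and
    [V(y) = sum_j 1_K(y - h theta_j) theta_j].  By translation
    invariance the integral of [phi . V] is the sum over [j] of the integrals over
    [K] of [theta_j . phi(x + h theta_j)]; divided by [h] it tends to [2l] times
    the integral of [div phi], because the [theta_j] sum to zero and their
    matrices [theta_j theta_j^T] sum to [2l] times the identity ([flux_cvg]).  On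
    the other hand [|V|] is controlled by the sum of the [|V . theta_k|]
    ([sum_abs_proj]), with a constant that makes the final bound sharp as [l]
    grows: this is Cauchy's formula, which recovers a length from its projections.
    The reflection [theta_j |-> theta_j - 2 (theta_j . theta_k) theta_k] permutes the
    polygon and changes the sign of [theta_j . theta_k], so that [V . theta_k] is
    half a combination of differences [1_K(. - a) - 1_K(. - b)] with [a - b]
    parallel to [theta_k] ([sum_cos_antisym]).  The [L^1] norm of such a
    difference is at most [2 |a - b| D]: moving [K] by [s] removes at most a
    length [s] from each chord in the direction of the motion, and these chords
    fill a strip of width at most [D] ([convex_shift_lost]).  Altogether
    [cos (pi / 4l) * int_K div phi <= pi D] ([divergence_bound_directions]), and
    [l] tends to infinity.

    Therefore the integral of [f div phi] is at most the sum of the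
    [c_k pi r / (2 alpha_k)], that is at most [N pi r / 2]. *)

(** [plane R] is [R * R] with the sigma-algebra on which [lebesgue2] is a
    measure. *)
Local Notation plane R := (measurableTypeR R * measurableTypeR R)%type.

(** * Measurability in the plane *)

HB.instance Definition _ (R : realType) := Measure.on (@lebesgue2 R).

Section PlaneMeasurability.
Context {R : realType}.

(** The square balls with rational centre and radius are countably many and
    form a base of the topology. *)
Lemma open_measurable_plane (U : set (plane R)) :
  open (U : set (R * R)) -> measurable U.
Proof.
move=> oU.
pose B (p q r : rat) : set (R * R) :=
  ball (ratr p : R) (ratr r : R) `*` ball (ratr q : R) (ratr r : R).
pose C (p q r : rat) := if `[< B p q r `<=` U >] then B p q r else set0.
rewrite (_ : U = \bigcup_p \bigcup_q \bigcup_r C p q r); last first.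
  apply/seteqP; split=> [x Ux|x [p _ [q _ [r _]]]]; last first.
    by rewrite /C; case: asboolP => // + Bx; exact.
  have /nbhs_ballP[e /= e0 eU] : nbhs (x : R * R) U by exact: open_nbhs_nbhs.
  have e2 : 0 < e / 2 by lra.
  have [r] := rat_in_itvoo e2.
  rewrite in_itv /= => /andP[r0 re].
  have approx (a : R) : exists p : rat, `|a - ratr p| < ratr r.
    have ar : a < a + ratr r by lra.
    have [p] := rat_in_itvoo ar.
    rewrite in_itv /= => /andP[ap pr]; exists p.
    rewrite distrC gtr0_norm ?subr_gt0 //; lra.
  have [[p xp] [q xq]] := (approx x.1, approx x.2).
  exists p => //; exists q => //; exists r => //.
  rewrite /C; case: asboolP => [_|]; last first.
    case=> -[y1 y2] [/= y1p y2q]; apply: eU; split => /=.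
      move: y1p xp; rewrite -!ball_normE /ball_ /= => y1p xp.
      rewrite (_ : x.1 - y1 = (x.1 - ratr p) + (ratr p - y1)); last by ring.
      by apply: le_lt_trans (ler_normD _ _) _; lra.
    move: y2q xq; rewrite -!ball_normE /ball_ /= => y2q xq.
    rewrite (_ : x.2 - y2 = (x.2 - ratr q) + (ratr q - y2)); last by ring.
    by apply: le_lt_trans (ler_normD _ _) _; lra.
  by split => /=; rewrite -ball_normE /ball_ /= distrC.
do 3 (apply: bigcupT_measurable_rat => ?).
rewrite /C; case: asboolP => // _.
by apply: measurableX; apply: open_measurable; exact: ball_open.
Qed.

Lemma closed_measurable_plane (U : set (plane R)) :
  closed (U : set (R * R)) -> measurable U.
Proof. by move/closed_openC/open_measurable_plane/measurableC; rewrite setCK. Qed.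

Lemma continuous_measurable_plane (f : plane R -> R) :
  continuous (f : R * R -> R) -> measurable_fun [set: plane R] f.
Proof.
move=> /continuousP cf; apply: (measurability _ (RGenOpens.measurableE R)).
move=> _ [_ [a [b ->] <-]]; rewrite setTI; apply: open_measurable_plane.
exact/cf/interval_open.
Qed.
End PlaneMeasurability.

(** * Translations, shears and slices *)

Section Translation.
Context {R : realType}.
Local Notation mu := (@lebesgue_measure R).
Local Open Scope ereal_scope.

Lemma measurable_shift (a : R) :
  measurable_fun [set: measurableTypeR R] (fun x : measurableTypeR R => (x + a)%R : measurableTypeR R).
Proof. exact: measurable_funD. Qed.

Lemma lebesgue_measure_shift (a : R) (A : set (measurableTypeR R)) :
  measurable A -> mu [set x | A (x + a)%R] = mu A.
Proof.
move=> mA.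
pose nu := pushforward mu (fun x : measurableTypeR R => (x + a)%R : measurableTypeR R).
have := measurable_shift a => ms.
transitivity (nu A) => //.
apply/esym/lebesgue_measure_unique => //= _ [[u v]] _ <-.
rewrite /nu /pushforward /=.
rewrite (_ : _ @^-1` _ = `](u - a)%R, (v - a)%R]%classic); last first.
  by apply/seteqP; split => x /=; rewrite !in_itv /= ltrBlDr lerBrDr.
rewrite !lebesgue_measure_itv /= !lte_fin ltrD2r.
by case: ifP => // _; rewrite -!EFinD; congr EFin; ring.
Qed.

End Translation.

Section SliceBound.
Context {R : realType}.
Local Notation mu := (@lebesgue_measure R).
Local Open Scope ereal_scope.

Lemma lebesgue2_shift (z : R * R) (A : set (plane R)) : measurable A ->
  lebesgue2 [set x | A (x.1 + z.1, x.2 + z.2)%R] = lebesgue2 A.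
Proof.
move=> mA.
pose sh (x : plane R) : plane R := ((x.1 + z.1)%R : measurableTypeR R, (x.2 + z.2)%R : measurableTypeR R).
have msh : measurable_fun [set: plane R] sh.
  apply: measurable_fun_pair; first exact: (measurableT_comp (measurable_shift z.1)).
  exact: (measurableT_comp (measurable_shift z.2)).
have -> : lebesgue2 [set x | A (x.1 + z.1, x.2 + z.2)%R] =
    pushforward (mu \x mu) sh A by [].
apply/esym; apply: product_measure_unique => // B C mB mC.
transitivity ((mu \x mu) ([set x | B (x + z.1)%R] `*` [set y | C (y + z.2)%R])) => //.
have mB' : measurable ([set x | B (x + z.1)%R] : set (measurableTypeR R)).
  by rewrite -[X in measurable X]setTI; exact: measurable_shift.
have mC' : measurable ([set x | C (x + z.2)%R] : set (measurableTypeR R)).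
  by rewrite -[X in measurable X]setTI; exact: measurable_shift.
rewrite product_measure1E //.
by congr (_ * _); exact: lebesgue_measure_shift.
Qed.

Lemma measurable_shear (a : R) :
  measurable_fun [set: plane R]
    (fun x : plane R => (x.1, (x.2 + a * x.1)%R) : plane R).
Proof.
apply: measurable_fun_pair; first exact: measurable_fst.
apply: measurable_funD; first exact: measurable_snd.
by apply: measurable_funM => //; exact: measurable_fst.
Qed.

Lemma shear_preimage_measurable (a : R) (E : set (plane R)) : measurable E ->
  measurable ([set x | E (x.1, (x.2 + a * x.1)%R)] : set (plane R)).
Proof.
by move=> mE; rewrite -[X in measurable X]setTI; exact: measurable_shear.
Qed.

(** Shears preserve area: vertical sections are only translated. Fubini then
    expresses the area by the sections along lines of slope [a], parametrized
    by their intercept [y] and their abscissa [x]. *)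
Lemma lebesgue2_shear (a : R) (E : set (plane R)) : measurable E ->
  lebesgue2 E = \int[mu]_y mu [set x | E (x, (y + a * x)%R)].
Proof.
move=> mE.
pose G : set (plane R) := [set x | E (x.1, (x.2 + a * x.1)%R)].
have mG : measurable G by exact: shear_preimage_measurable.
transitivity ((mu \x mu) G).
  apply: eq_integral => x _ /=.
  rewrite -(@lebesgue_measure_shift _ (a * x) (xsection E x)); last exact: measurable_xsection.
  by congr (mu _); apply/seteqP; split => y /=; rewrite /xsection /= !inE.
transitivity ((mu \x^ mu) G).
  by apply: product_measure_unique => // B C mB mC; exact: product_measure2E.
by apply: eq_integral => y _ /=; congr (mu _); apply/seteqP; split => x /=; rewrite /ysection /= !inE.
Qed.

Lemma integral_le_box (h : measurableTypeR R -> \bar R) (A B u : R) :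
  measurable_fun [set: measurableTypeR R] h -> (forall x, 0 <= h x) ->
  (0 <= A)%R -> (0 <= B)%R -> (forall x, h x <= A%:E) ->
  (forall x, ~~ (u <= x <= u + B)%R -> h x = 0) ->
  \int[mu]_x h x <= (A * B)%:E.
Proof.
move=> mh h0 A0 B0 hA hB.
pose I : set (measurableTypeR R) := `[u, (u + B)%R]%classic.
have mI : measurable I by exact: measurable_itv.
have muI : mu I <= B%:E.
  rewrite /I lebesgue_measure_itv /= lte_fin; case: ifPn => _; last by rewrite lee_fin.
  by rewrite -EFinD lee_fin (addrC u) addrK.
have mA : measurable_fun [set: measurableTypeR R] (fun x => A%:E * (\1_I x)%:E).
  by apply: emeasurable_funM => //; apply/measurable_EFinP; exact: measurable_indic.
apply: (@le_trans _ _ (\int[mu]_x (A%:E * (\1_I x)%:E))).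
  apply: ge0_le_integral => // x _.
  rewrite indicE; case: (boolP (x \in I)); rewrite ?notin_setE ?inE /I /= in_itv /=.
    by move=> _; rewrite mule1.
  by move=> /negP xN; rewrite mule0 hB.
rewrite ge0_integralZl //; last first.
  by apply/measurable_EFinP; exact: measurable_indic.
rewrite EFinM lee_wpmul2l ?lee_fin // integral_indic // setIT.
exact: muI.
Qed.

(* Up to replacing [w] by its opposite, every unit vector is of this form. *)
Let slice_bound_pos (E : set (plane R)) (w : R * R) (A B u : R) :
  measurable E -> (0 < w.1)%R \/ w = (0, 1)%R -> (0 <= A)%R -> (0 <= B)%R ->
  (forall z, E z -> (u <= w.1 * z.2 - w.2 * z.1 <= u + B)%R) ->
  (forall z : R * R, exists t0 : R, forall t : R,
    E (z.1 + t * w.1, z.2 + t * w.2)%R -> (t0 <= t <= t0 + A)%R) ->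
  lebesgue2 E <= (A * B)%:E.
Proof.
move=> mE wP A0 B0 strip chord.
have itv_le (S : set (measurableTypeR R)) (a b : R) : (a <= b)%R ->
    measurable S -> (forall x, S x -> (a <= x <= b)%R) -> mu S <= (b - a)%:E.
  move=> ab mS Sab; apply: (@le_trans _ _ (mu `[a, b]%classic)).
    by apply: le_measure; rewrite ?inE // => x Sx /=; rewrite in_itv /= Sab.
  by rewrite lebesgue_measure_itv /= lte_fin; case: ifPn => _; rewrite ?lee_fin ?subr_ge0.
case: wP => [w0|wE]; last first.
  rewrite /lebesgue2 /product_measure1.
  have strip' x y : E (x, y) -> (- (u + B) <= x <= - (u + B) + B)%R.
    by move=> /strip; rewrite wE /= => /andP[? ?]; apply/andP; split; lra.
  apply: (@integral_le_box _ A B (- (u + B))) => //.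
  - exact: measurable_fun_xsection.
  - move=> x /=; have [t0 Ht0] := chord (x, 0)%R.
    rewrite (_ : A = t0 + A - t0)%R; last by ring.
    apply: itv_le; [lra|exact: measurable_xsection|].
    move=> y; rewrite /xsection /= inE => Exy; apply: Ht0.
    by rewrite wE /= mulr0 mulr1 addr0 add0r.
  - move=> x xN /=; rewrite (_ : xsection E x = set0) ?measure0 //.
    rewrite -subset0 => y; rewrite /xsection /= inE => Exy.
    by move: xN; rewrite (strip' _ _ Exy).
rewrite (lebesgue2_shear (w.2 / w.1) mE).
have wN0 : w.1 != 0%R by rewrite gt_eqF.
pose G : set (plane R) := [set x | E (x.1, (x.2 + (w.2 / w.1) * x.1)%R)].
have mG : measurable G by exact: shear_preimage_measurable.
rewrite (_ : A * B = (w.1 * A) * (B / w.1))%R; last by field.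
apply: (@integral_le_box _ _ _ (u / w.1)).
- rewrite (_ : (fun y => _) = (fun y => mu (ysection G y))).
    exact: measurable_fun_ysection.
  by apply/funext => y; congr (mu _); apply/seteqP; split => x /=; rewrite /ysection /= !inE.
- by [].
- by rewrite mulr_ge0 // ltW.
- by rewrite divr_ge0 // ltW.
- move=> y; have [t0 Ht0] := chord (0, y)%R.
  rewrite (_ : w.1 * A = w.1 * (t0 + A) - w.1 * t0)%R; last by ring.
  apply: itv_le.
  + by rewrite ler_pM2l //; lra.
  + rewrite (_ : [set x | _] = ysection G y); first exact: measurable_ysection.
    by apply/seteqP; split => x /=; rewrite /ysection /= !inE.
  + move=> x /= Ex; have := Ht0 (x / w.1)%R.
    rewrite /= add0r divfK // (_ : x / w.1 * w.2 = w.2 / w.1 * x)%R; last by ring.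
    move=> /(_ Ex); rewrite ler_pdivlMr // ler_pdivrMr // => /andP[? ?].
    by apply/andP; split; lra.
- move=> y yN; rewrite (_ : [set x | _] = set0) ?measure0 //.
  rewrite -subset0 => x /= Ex; have := strip _ Ex => /=.
  rewrite (_ : _ - _ = w.1 * y)%R; last by field.
  move=> H; move: yN; rewrite -mulrDl ler_pdivrMr // ler_pdivlMr // (mulrC y).
  by rewrite H.
Qed.

(** If [E] lies in a strip of width [B] parallel to [w] and meets each line
    parallel to [w] within a segment of length [A], its area is at most [A *
    B]. When [w] is not vertical, the slices are those of a shear; the ratios
    [w.1 * A] and [B / w.1] between lengths along the axes and lengths along
    [w] cancel. *)
Lemma slice_bound (E : set (plane R)) (w : R * R) (A B u : R) :
  measurable E -> enorm w = 1%R -> (0 <= A)%R -> (0 <= B)%R ->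
  (forall z, E z -> (u <= w.1 * z.2 - w.2 * z.1 <= u + B)%R) ->
  (forall z : R * R, exists t0 : R, forall t : R,
    E (z.1 + t * w.1, z.2 + t * w.2)%R -> (t0 <= t <= t0 + A)%R) ->
  lebesgue2 E <= (A * B)%:E.
Proof.
move=> mE w1 A0 B0 strip chord.
have w2 : (w.1 ^+ 2 + w.2 ^+ 2 = 1)%R.
  by rewrite -[RHS](expr1n _ 2) -w1 /enorm sqr_sqrtr // addr_ge0 ?sqr_ge0.
have flip (w' : R * R) : (w'.1 = - w.1)%R -> (w'.2 = - w.2)%R ->
    (0 < w'.1)%R \/ w' = (0, 1)%R -> lebesgue2 E <= (A * B)%:E.
  move=> wx wy wP; apply: (@slice_bound_pos E w' A B (- (u + B))%R) => //.
    by move=> z /strip; rewrite wx wy => /andP[? ?]; apply/andP; split; lra.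
  move=> z; have [t0 Ht0] := chord z; exists (- (t0 + A))%R => t.
  rewrite wx wy !mulrN -!mulNr => /Ht0 /andP[? ?].
  by apply/andP; split; lra.
have [wlt|wgt|w0] := ltrgt0P w.1.
- by apply: (@slice_bound_pos E w A B u) => //; left.
- by apply: (flip (- w.1, - w.2)%R) => //=; left; rewrite oppr_gt0.
have : (w.2 == 1)%R || (w.2 == -1)%R.
  by rewrite -eqf_sqr expr1n; apply/eqP; rewrite -w2 w0 expr0n /= add0r.
case/orP=> /eqP w2E.
- by apply: (@slice_bound_pos E w A B u) => //; right; rewrite [w]surjective_pairing w0 w2E.
- by apply: (flip (- w.1, - w.2)%R) => //=; right; rewrite w0 w2E oppr0 opprK.
Qed.
End SliceBound.

(** * Translates of a convex set *)

Section ConvexShift.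
Context {R : realType}.
Implicit Types (K : set (R * R)) (p q w a b : R * R).

Definition dot p q : R := p.1 * q.1 + p.2 * q.2.

Definition cross w p : R := w.1 * p.2 - w.2 * p.1.

Lemma enorm_ge0 p : 0 <= enorm p. Proof. exact: sqrtr_ge0. Qed.

Lemma sqr_enorm p : enorm p ^+ 2 = p.1 ^+ 2 + p.2 ^+ 2.
Proof. by rewrite sqr_sqrtr // addr_ge0 ?sqr_ge0. Qed.

Lemma enormN p : enorm (- p) = enorm p.
Proof. by rewrite /enorm /= !sqrrN. Qed.

Lemma dot_le_enorm p q : dot p q <= enorm p * enorm q.
Proof.
rewrite /dot /enorm -sqrtrM ?addr_ge0 ?sqr_ge0 //.
apply: le_trans (ler_norm _) _; rewrite -sqrtr_sqr; apply: ler_wsqrtr.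
rewrite -subr_ge0 (_ : _ - _ = (p.1 * q.2 - p.2 * q.1) ^+ 2) ?sqr_ge0 //; ring.
Qed.

Lemma cross_le_enorm w p : enorm w = 1 -> cross w p <= enorm p.
Proof.
move=> w1; have := dot_le_enorm (- w.2, w.1) p.
rewrite (_ : enorm (- w.2, w.1) = 1); last first.
  by rewrite -w1 /enorm /= sqrrN addrC.
by rewrite mul1r /dot /= /cross mulNr addrC.
Qed.

Lemma convex_set_segment K p q (t : R) : convex_set K -> K p -> K q ->
  0 <= t <= 1 -> K (t * p.1 + (1 - t) * q.1, t * p.2 + (1 - t) * q.2).
Proof.
move=> cK Kp Kq /andP[t0 t1].
have := cK p q (Itv01 t0 t1); rewrite !inE; exact.
Qed.

(** Conditions on pairs of points turn into the intervals that [slice_bound]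
    requires, the lower end being the infimum. *)
Lemma narrow_interval (S : set R) (B : R) : 0 <= B ->
  (forall x y, S x -> S y -> y - x <= B) ->
  exists u, forall x, S x -> u <= x <= u + B.
Proof.
move=> B0 SB; have [->|/set0P[x0 Sx0]] := eqVneq S set0; first by exists 0.
have hS : has_inf S.
  by split; [exists x0|exists (x0 - B) => y Sy; have := SB _ _ Sy Sx0; lra].
exists (inf S) => x Sx; apply/andP; split; first by apply: ge_inf => //; case: hS.
rewrite -lerBlDr; apply: lb_le_inf; first by exists x0.
by move=> y Sy; have := SB _ _ Sy Sx; lra.
Qed.

Lemma measurable_translate (K : set (plane R)) a : measurable K ->
  measurable ([set y | K (y - a)] : set (plane R)).
Proof.
move=> mK; rewrite -[X in measurable X]setTI.
suff : measurable_fun [set: plane R] (fun y : plane R =>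
    ((y.1 - a.1) : measurableTypeR R, (y.2 - a.2) : measurableTypeR R) : plane R) by exact.
apply: measurable_fun_pair.
  exact: (measurableT_comp (measurable_shift (- a.1))).
exact: (measurableT_comp (measurable_shift (- a.2))).
Qed.

(** A convex set loses little area when it is moved from [a] to [b]: on a chord
    parallel to [b - a], two lost points are at distance at most [|a - b|], as
    otherwise the second one would still be covered by the moved chord. *)
Lemma convex_shift_lost (K : set (plane R)) (D : R) a b :
  measurable K -> convex_set (K : set (R * R)) -> 0 <= D ->
  (forall p q, K p -> K q -> enorm (p - q) <= D) ->
  (lebesgue2 [set y | K (y - a)%R /\ ~ K (y - b)%R] <= (enorm (a - b) * D)%:E)%E.
Proof.
move=> mK cK D0 KD.
have mE : measurable ([set y | K (y - a)%R /\ ~ K (y - b)%R] : set (plane R)).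
  apply: measurableD; exact: measurable_translate.
have [s0|sN0] := eqVneq (enorm (a - b)) 0.
  have ab : a = b.
    have := sqr_enorm (a - b); rewrite s0 expr0n /= => /esym/eqP.
    rewrite paddr_eq0 ?sqr_ge0 // !sqrf_eq0 !subr_eq0 => /andP[/eqP e1 /eqP e2].
    by rewrite [a]surjective_pairing [b]surjective_pairing e1 e2.
  have E0 : [set y | K (y - a)%R /\ ~ K (y - b)%R] = set0.
    by rewrite -subset0 => y /= []; rewrite ab.
  by rewrite E0 measure0 s0 mul0r.
(* Now slice along the unit vector [w] from [a] to [b]. *)
pose s := enorm (a - b); have s_gt0 : 0 < s by rewrite lt_def sN0 enorm_ge0.
pose w : R * R := ((b.1 - a.1) / s, (b.2 - a.2) / s).
have w1 : enorm w = 1.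
  have sE : (b.1 - a.1) ^+ 2 + (b.2 - a.2) ^+ 2 = s ^+ 2.
    by rewrite sqr_enorm /=; ring.
  by rewrite /enorm /= !expr_div_n -mulrDl sE divff ?sqrtr1 // expf_neq0.
have [u uP] : exists u, forall x,
    (exists2 z, K (z - a)%R /\ ~ K (z - b)%R & x = cross w z) -> u <= x <= u + D.
  apply: (narrow_interval D0) => x y [z [Kz _] ->] [z' [Kz' _] ->].
  rewrite (_ : _ - _ = cross w (z' - z)); last by rewrite /cross /=; ring.
  apply: le_trans (cross_le_enorm _ w1) _.
  by rewrite (_ : z' - z = (z' - a) - (z - a)) ?KD // opprB addrA subrK.
apply: (@slice_bound _ _ w s D u) => //; first exact: ltW.
  by move=> z Ez; apply: uP; exists z.
move=> z; apply: narrow_interval; first exact: ltW.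
move=> t t' [K1 K2] [K1' K2']; rewrite leNgt; apply/negP => st.
apply: K2'.
(* [z + t' w - b] is [z + (t' - s) w - a]: between two points of [K]. *)
pose r := s / (t' - t).
have tt : 0 < t' - t by lra.
have r01 : 0 <= r <= 1.
  by rewrite /r divr_ge0 ?(ltW s_gt0) ?(ltW tt) //= ler_pdivrMr // mul1r (ltW st).
have := convex_set_segment cK K1 K1' r01.
congr K; rewrite /w /= /r; congr pair => /=; field; rewrite !gt_eqF //.
Qed.
End ConvexShift.

(** * Integrals over the plane *)

Section PlaneIntegrals.
Context {R : realType}.
Local Notation mu := (@lebesgue_measure R).
Local Notation mu2 := (@lebesgue2 R).
Local Notation L1 g := (mu2.-integrable [set: plane R] (EFin \o g)).
Implicit Types (K : set (plane R)) (g G : plane R -> R).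

Lemma lebesgue2_bounded_fin K (M : R) : measurable K ->
  (forall x : R * R, K x -> `|x| <= M) -> (mu2 K < +oo)%E.
Proof.
move=> mK KM.
pose I : set (measurableTypeR R) := `[- M, M]%classic.
have mI : measurable I by exact: measurable_itv.
have mII : measurable (I `*` I) by exact: measurableX.
apply: (@le_lt_trans _ _ (mu2 (I `*` I))).
  apply: le_measure; rewrite ?inE // => x /KM.
  rewrite prod_normE ge_max !ler_norml /= => /andP[? ?].
  by split; rewrite /I /= in_itv.
have -> : mu2 (I `*` I) = (mu I * mu I)%E by exact: product_measure1E.
have : (mu I < +oo)%E.
  by rewrite /I lebesgue_measure_itv /=; case: ifP => _; rewrite -?EFinD ltry.
by move=> fI; rewrite lte_mul_pinfty // ge0_fin_numE.
Qed.

Lemma integrable_indic_mul K g (M C : R) : measurable K ->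
  (forall x : R * R, K x -> `|x| <= M) ->
  measurable_fun [set: plane R] g -> (forall x, K x -> `|g x| <= C) ->
  L1 (fun x => \1_K x * g x).
Proof.
move=> mK KM mg gC.
have -> : EFin \o (fun x => \1_K x * g x) = (EFin \o g) \_ K.
  apply/funext => x; rewrite patchE /= indicE.
  by case: (x \in K); rewrite ?mul1r ?mul0r.
apply/(integrable_mkcond (EFin \o g) mK).
apply: measurable_bounded_integrable => //.
- exact: lebesgue2_bounded_fin KM.
- exact: measurable_funTS.
- exists C; split; first exact: num_real.
  by move=> B CB x Kx; apply: le_trans (gC _ Kx) (ltW CB).
Qed.

Lemma integrable_sum_real (n : nat) (G : nat -> plane R -> R) : (forall j, L1 (G j)) ->
  L1 (fun x => \sum_(0 <= j < n) G j x).
Proof.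
move=> iG.
have -> : EFin \o (fun x => \sum_(0 <= j < n) G j x) =
    (fun x => \sum_(0 <= j < n) (G j x)%:E)%E.
  by apply/funext => x /=; rewrite sumEFin.
by apply: integrable_sum => // j _; exact: iG.
Qed.

Lemma Rintegral_sum (n : nat) (G : nat -> plane R -> R) : (forall j, L1 (G j)) ->
  \int[mu2]_x (\sum_(0 <= j < n) G j x) = \sum_(0 <= j < n) \int[mu2]_x G j x.
Proof.
move=> iG; elim: n => [|n IH].
  rewrite big_geq //; under eq_Rintegral do rewrite big_geq //.
  by rewrite Rintegral_cst // mul0r.
rewrite big_nat_recr //= -IH -RintegralD //; last exact: integrable_sum_real.
by apply: eq_Rintegral => x _; rewrite big_nat_recr.
Qed.

Lemma integrableZ_real (c : R) g : L1 g -> L1 (fun x => c * g x).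
Proof. by move=> ig; exact: (integrableZl measurableT c ig). Qed.

Section Shift.
Variable a : R * R.
Let sh (x : plane R) : plane R := ((x.1 + a.1) : measurableTypeR R, (x.2 + a.2) : measurableTypeR R).

Let msh : measurable_fun [set: plane R] sh.
Proof.
apply: measurable_fun_pair; first exact: (measurableT_comp (measurable_shift a.1)).
exact: (measurableT_comp (measurable_shift a.2)).
Qed.

Lemma integrable_shift g : L1 g -> L1 (fun x => g (x + a)).
Proof.
move=> /integrableP[mg ig]; apply/integrableP; split.
  exact: (measurableT_comp mg msh).
rewrite (_ : (\int[mu2]_x _)%E = (\int[mu2]_x `|(EFin \o g) x|)%E) //.
transitivity (\int[pushforward mu2 sh]_x `|(EFin \o g) x|)%E.
  by rewrite ge0_integral_pushforward //; exact: measurableT_comp.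
by apply: eq_measure_integral => A mA _; exact: lebesgue2_shift.
Qed.

Lemma Rintegral_shift g : L1 g -> \int[mu2]_x g (x + a) = \int[mu2]_x g x.
Proof.
move=> ig; rewrite /Rintegral; congr fine.
transitivity (\int[pushforward mu2 sh]_x ((EFin \o g) x))%E.
  rewrite integral_pushforward //; first by case/integrableP: ig.
  exact: integrable_shift.
by apply: eq_measure_integral => A mA _; exact: lebesgue2_shift.
Qed.
End Shift.

Lemma Rintegral_translate K a g (M C : R) : measurable K ->
  (forall x : R * R, K x -> `|x| <= M) ->
  measurable_fun [set: plane R] g -> (forall x, `|g x| <= C) ->
  \int[mu2]_x (\1_K x * g (x + a)) = \int[mu2]_x (\1_[set y | K (y - a)] x * g x).
Proof.
move=> mK KM mg gC.
have mKa : measurable ([set y | K (y - a)] : set (plane R)) by exact: measurable_translate.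
rewrite -(@Rintegral_shift a (fun x => \1_[set y | K (y - a)] x * g x)).
  apply: eq_Rintegral => x _; congr (_ * _); rewrite !indicE; congr ((_ : bool)%:R).
  by apply/idP/idP; rewrite !inE /= addrK.
apply: (@integrable_indic_mul _ _ (M + `|a|) C) => // x /= /KM xM.
rewrite -(subrK a x); apply: le_trans (ler_normD _ _) _.
by rewrite lerD2r.
Qed.

(** The absolute value is the indicator of what is lost from [a] to [b] plus
    that of what is lost from [b] to [a]. *)
Lemma Rintegral_convex_shift K (D M : R) a b :
  measurable K -> convex_set (K : set (R * R)) -> 0 <= D ->
  (forall x : R * R, K x -> `|x| <= M) ->
  (forall p q : R * R, K p -> K q -> enorm (p - q) <= D) ->
  \int[mu2]_y `|\1_[set y | K (y - a)] y - \1_[set y | K (y - b)] y| <=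
    2 * (enorm (a - b) * D).
Proof.
move=> mK cK D0 KM KD.
have mKt c := measurable_translate c mK.
pose E c d : set (plane R) := [set y | K (y - c)%R /\ ~ K (y - d)%R].
have mE c d : measurable (E c d) by apply: measurableD; exact: mKt.
have fE c d : (mu2 (E c d) <= (enorm (c - d) * D)%:E)%E by exact: convex_shift_lost.
have fE' c d : mu2 (E c d) \is a fin_num.
  by rewrite ge0_fin_numE //; apply: le_lt_trans (fE c d) _; rewrite ltry.
rewrite (_ : 2 * _ = enorm (a - b) * D + enorm (b - a) * D); last first.
  by rewrite -(enormN (b - a)) opprB; ring.
rewrite -lee_fin /Rintegral.
have -> : (\int[mu2]_x `|\1_[set y | K (y - a)] x - \1_[set y | K (y - b)] x|%:E)%E =
    (mu2 (E a b) + mu2 (E b a))%E.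
  transitivity (\int[mu2]_x ((\1_(E a b) x)%:E + (\1_(E b a) x)%:E))%E.
    apply: eq_integral => x _; rewrite -EFinD; congr EFin.
    rewrite !indicE.
    have memE c d : (x \in E c d) = (x \in [set y | K (y - c)]) && (x \notin [set y | K (y - d)]).
      by apply/idP/andP; rewrite !inE notin_setE.
    rewrite !memE; case: (_ \in _); case: (_ \in _) => /=;
      by rewrite ?subrr ?subr0 ?sub0r ?normrN ?normr0 ?normr1 ?addr0 ?add0r.
  rewrite ge0_integralD //; first by rewrite !integral_indic ?setIT.
  - by apply/measurable_EFinP; exact: measurable_indic.
  - by apply/measurable_EFinP; exact: measurable_indic.
rewrite fineK; last by rewrite fin_numD !fE'.
rewrite EFinD; by apply: leeD; exact: fE.
Qed.

End PlaneIntegrals.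

(** * Sums over the vertices of a regular polygon *)

Lemma sum_periodic_shift (V : zmodType) (F : nat -> V) (n k : nat) :
  (forall j, F (j + n)%N = F j) ->
  \sum_(0 <= j < n) F (j + k)%N = \sum_(0 <= j < n) F j.
Proof.
elim: k => [|k IH] Fn; first by under eq_bigr do rewrite addn0.
rewrite -IH //.
case: n Fn IH => [|n] Fn _; first by rewrite !big_geq.
rewrite big_nat_recr //= [RHS]big_nat_recl //= addrC.
congr (_ + _); first by rewrite addnC addSnnS Fn.
by apply: eq_bigr => j _; rewrite addSnnS.
Qed.

(** The angle between consecutive vertices of a regular [4l]-gon. *)
Definition dir_step (R : realType) (l : nat) : R := pi / (2 * l%:R).

Definition dir_angle (R : realType) (l j : nat) : R := j%:R * dir_step R l.

Section Directions.
Context {R : realType} (l : nat).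
Hypothesis l_gt0 : (0 < l)%N.

Local Notation tau := (dir_step R l).
Local Notation ang := (@dir_angle R l).

Let lR : 0 < l%:R :> R. Proof. by rewrite ltr0n. Qed.

Let angD j k : ang (j + k) = ang j + ang k.
Proof. by rewrite /dir_angle natrD mulrDl. Qed.

Let ang_l : ang l = pi / 2.
Proof. by rewrite /dir_angle /dir_step; field; rewrite gt_eqF. Qed.

Let ang_2l : ang (2 * l) = pi.
Proof. by rewrite /dir_angle /dir_step natrM; field; rewrite gt_eqF. Qed.

Let ang_4l : ang (4 * l) = pi *+ 2.
Proof. by rewrite /dir_angle /dir_step natrM mulr2n; field; rewrite gt_eqF. Qed.

(** A half turn permutes the polygon and changes signs. *)
Lemma sum_cos_ang : \sum_(0 <= j < 4 * l) cos (ang j) = 0.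
Proof.
have /eqP : \sum_(0 <= j < 4 * l) cos (ang j) = - \sum_(0 <= j < 4 * l) cos (ang j).
  rewrite -{1}(@sum_periodic_shift _ (cos \o ang) _ (2 * l)) /=; last first.
    by move=> j; rewrite angD ang_4l mulr2n addrA !cosDpi opprK.
  by rewrite -sumrN; apply: eq_bigr => j _; rewrite angD ang_2l cosDpi.
by rewrite -addr_eq0 -mulr2n mulrn_eq0 /= => /eqP.
Qed.

Lemma sum_sin_ang : \sum_(0 <= j < 4 * l) sin (ang j) = 0.
Proof.
have /eqP : \sum_(0 <= j < 4 * l) sin (ang j) = - \sum_(0 <= j < 4 * l) sin (ang j).
  rewrite -{1}(@sum_periodic_shift _ (sin \o ang) _ (2 * l)) /=; last first.
    by move=> j; rewrite angD ang_4l mulr2n addrA !sinDpi opprK.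
  by rewrite -sumrN; apply: eq_bigr => j _; rewrite angD ang_2l sinDpi.
by rewrite -addr_eq0 -mulr2n mulrn_eq0 /= => /eqP.
Qed.

(** A quarter turn permutes the polygon (whence the multiple of 4) and
    exchanges [cos ^+ 2] with [sin ^+ 2], whose sum is 1. *)
Lemma sum_cos2_ang a : \sum_(0 <= j < 4 * l) cos (ang j - a) ^+ 2 = 2 * l%:R.
Proof.
set C := LHS.
have CS : C = \sum_(0 <= j < 4 * l) sin (ang j - a) ^+ 2.
  rewrite /C -(@sum_periodic_shift _ (fun j => cos (ang j - a) ^+ 2) _ l) /=; last first.
    by move=> j; rewrite angD ang_4l mulr2n addrA addrAC (addrAC _ pi) !cosDpi opprK.
  by apply: eq_bigr => j _; rewrite angD ang_l addrAC cosDpihalf sqrrN.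
have : C + C = (4 * l)%:R.
  rewrite {2}CS -big_split /= (eq_bigr (fun=> 1)); last first.
    by move=> j _; rewrite cos2Dsin2.
  by rewrite big_const_nat iter_addr_0 subn0.
rewrite natrM; lra.
Qed.

Lemma sum_cossin_ang : \sum_(0 <= j < 4 * l) cos (ang j) * sin (ang j) = 0.
Proof.
set C := LHS.
have CS : C = - C.
  rewrite /C -{1}(@sum_periodic_shift _ (fun j => cos (ang j) * sin (ang j)) _ l) /=; last first.
    by move=> j; rewrite angD ang_4l mulr2n addrA !cosDpi !sinDpi !opprK.
  rewrite -sumrN; apply: eq_bigr => j _.
  by rewrite angD ang_l cosDpihalf sinDpihalf mulNr mulrC.
by lra.
Qed.

(** The direction of angle [2 a + pi - t] is the mirror image of that of angle
    [t] in the line orthogonal to the direction of angle [a]; this reflection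
    permutes the polygon when [a] is the angle of a vertex. *)
Lemma sum_reflect (k : nat) (G : R -> R) : (forall t, G (t + pi *+ 2) = G t) ->
  \sum_(0 <= j < 4 * l) G (ang k *+ 2 + pi - ang j) =
  \sum_(0 <= j < 4 * l) G (ang j).
Proof.
move=> Gp.
rewrite big_nat_rev /= add0n.
rewrite -(@sum_periodic_shift _ (G \o ang) _ (2 * k + 2 * l + 1)) /=; last first.
  by move=> j; rewrite angD ang_4l Gp.
apply: eq_big_nat => j /andP[_ jn]; rewrite -[LHS]Gp; congr G.
have -> : ang (4 * l - j.+1) = pi *+ 2 - ang j.+1.
  by rewrite -ang_4l -{2}(subnK jn) angD addrK.
rewrite -(addn1 j) (angD j) (angD j) (angD _ 1) (angD (2 * k)) ang_2l.
rewrite mul2n -addnn angD !mulr2n; ring.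
Qed.

(** The reflection of [sum_reflect] changes the sign of the cosine, so that
    only differences of [u] between mirror images matter. *)
Lemma sum_cos_antisym (k : nat) (u : R -> R) : (forall t, u (t + pi *+ 2) = u t) ->
  2 * \sum_(0 <= j < 4 * l) cos (ang j - ang k) * u (ang j) =
  \sum_(0 <= j < 4 * l) cos (ang j - ang k) *
     (u (ang j) - u (ang k *+ 2 + pi - ang j)).
Proof.
move=> up.
have -> : \sum_(0 <= j < 4 * l) cos (ang j - ang k) *
     (u (ang j) - u (ang k *+ 2 + pi - ang j)) =
   \sum_(0 <= j < 4 * l) cos (ang j - ang k) * u (ang j) +
   \sum_(0 <= j < 4 * l) cos (ang k *+ 2 + pi - ang j - ang k) * u (ang k *+ 2 + pi - ang j).
  rewrite -big_split /=; apply: eq_bigr => j _; rewrite mulrBr; congr (_ + _).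
  rewrite -mulNr; congr (_ * _).
  rewrite -cosN -cosDpi; congr cos; rewrite mulr2n; ring.
rewrite (@sum_reflect k (fun t => cos (t - ang k) * u t)); last first.
  by move=> t; rewrite up mulr2n addrAC addrA !cosDpi opprK.
by rewrite -mulr2n mulr_natl.
Qed.

Lemma sign_change (g : nat -> R) n : (0 < n)%N -> g 0%N <= 0 -> 0 <= g n ->
  exists j, g j <= 0 /\ 0 <= g j.+1.
Proof.
elim: n => // -[|n] IH _ g0 gn; first by exists 0%N.
by have [gn1|gn1] := lerP 0 (g n.+1); [exact: IH|exists n.+1; rewrite ltW].
Qed.

(** A discrete form of Cauchy's formula. Start at a vertex [j] where the
    projection [g] of [v] changes sign from negative to positive. Dropping the
    absolute values on the next half turn costs nothing in a lower bound, and
    there the sum telescopes to the component [b] of [v] along the axis of that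
    half turn. The two signs at the ends say that [v] makes an angle at most
    [d], half a step, with this axis, whence [cos d * enorm v <= b]. *)
Lemma sum_abs_proj (v : R * R) :
  2 * cos (tau / 2) * enorm v <=
  sin (tau / 2) * \sum_(0 <= k < 4 * l) `|v.1 * cos (ang k) + v.2 * sin (ang k)|.
Proof.
pose d := tau / 2; rewrite -/d.
have tauE : tau = d + d by rewrite /d; lra.
have tau_gt0 : 0 < tau by rewrite /dir_step divr_gt0 ?pi_gt0 // mulr_gt0.
have tau_le : tau <= pi / 2.
  rewrite /dir_step ler_pM2l ?pi_gt0 // lef_pV2 ?posrE ?mulr_gt0 //.
  by rewrite ler_peMr // ler1n.
have pi0 := pi_gt0 R.
have sd : 0 < sin d by apply: sin_gt0_pi; rewrite /d; apply/andP; split; lra.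
have cd : 0 < cos d by apply: cos_gt0_pihalf; rewrite /d; apply/andP; split; lra.
pose g k := v.1 * cos (ang k) + v.2 * sin (ang k).
have gN k : g (k + 2 * l)%N = - g k.
  by rewrite /g angD ang_2l cosDpi sinDpi; ring.
have gP k : g (k + 4 * l)%N = g k.
  by rewrite (_ : (k + 4 * l = k + 2 * l + 2 * l)%N) ?gN ?opprK //; lia.
(* [g] takes opposite values at 0 and at [2l], so it changes sign upwards. *)
have [j [gj0 gj1]] : exists j, g j <= 0 /\ 0 <= g j.+1.
  have l2 : (0 < 2 * l)%N by lia.
  have [g0|/ltW g0] := lerP (g 0%N) 0.
    by apply: (@sign_change _ (2 * l)) => //; rewrite -[(2 * l)%N]add0n gN oppr_ge0.
  have [||j ?] := @sign_change (fun k => g (k + 2 * l)%N) (2 * l) l2.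
  - by rewrite gN oppr_le0.
  - by rewrite gN -[(2 * l)%N]add0n gN opprK.
  - by exists (j + 2 * l)%N.
(* A discrete primitive of [g]. *)
pose H k := v.1 * sin (ang k - d) - v.2 * cos (ang k - d).
have HN k : H (k + 2 * l)%N = - H k.
  by rewrite /H angD ang_2l addrAC cosDpi sinDpi; ring.
have Hg k : 2 * sin d * g k = H k.+1 - H k.
  rewrite /H /g -(addn1 k) angD (_ : ang 1 = d + d); last by rewrite /dir_angle mul1r.
  rewrite addrA addrK !sinD !cosD !sinN !cosN; ring.
have S_ge : 2 * \sum_(0 <= i < 2 * l) g (i + j.+1)%N <= \sum_(0 <= k < 4 * l) `|g k|.
  rewrite -(@sum_periodic_shift _ (fun k => `|g k|) _ j.+1); last by move=> k; rewrite gP.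
  rewrite [leRHS](@big_cat_nat _ _ _ (2 * l)) //=; last by lia.
  rewrite [X in _ <= _ + X](_ : _ = \sum_(0 <= i < 2 * l) `|g (i + 2 * l + j.+1)%N|); last first.
    by rewrite -{1}(add0n (2 * l)%N) big_addn (_ : (4 * l - 2 * l = 2 * l)%N) //; lia.
  rewrite -big_split /= mulr_sumr; apply: ler_sum => i _.
  rewrite (_ : (i + 2 * l + j.+1 = i + j.+1 + 2 * l)%N); last by lia.
  by rewrite gN normrN; have := ler_norm (g (i + j.+1)%N); lra.
have SH : sin d * (2 * \sum_(0 <= i < 2 * l) g (i + j.+1)%N) = - 2 * H j.+1.
  rewrite mulrCA mulrA mulr_sumr; under eq_bigr do rewrite Hg -addSn.
  rewrite (telescope_sumr (fun i => H (i + j.+1)%N)) //.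
  by rewrite addnC HN add0n; ring.
rewrite -/d -/(g _); apply: le_trans (ler_wpM2l (ltW sd) S_ge); rewrite SH.
(* [m] is the angle halfway between the vertices [j] and [j.+1]. *)
have [m mE] : exists m, m = ang j.+1 - d by eexists.
pose a := v.1 * cos m + v.2 * sin m.
have -> : - 2 * H j.+1 = 2 * - H j.+1 by ring.
rewrite -mulrA ler_pM2l //.
pose b := - H j.+1; rewrite -/b.
have bE : b = v.2 * cos m - v.1 * sin m by rewrite /b /H -mE; ring.
have ja : g j.+1 = a * cos d + b * sin d.
  rewrite bE /a /g (_ : ang j.+1 = m + d) ?cosD ?sinD; last by rewrite mE subrK.
  ring.
have jb : g j = a * cos d - b * sin d.
  rewrite bE /a /g (_ : ang j = m - d) ?cosB ?sinB; first by ring.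
  rewrite mE -(addn1 j) angD (_ : ang 1 = d + d); last by rewrite /dir_angle mul1r.
  by rewrite addrA !addrK.
have b0 : 0 <= b.
  have : 0 <= b * sin d by move: gj0 gj1; rewrite ja jb; lra.
  by rewrite pmulr_lge0.
have ab : (a * cos d) ^+ 2 <= (b * sin d) ^+ 2.
  rewrite -[leLHS]real_normK ?num_real // ler_sqr ?nnegrE //; last by rewrite mulr_ge0 // ltW.
  by rewrite ler_norml; move: gj0 gj1; rewrite ja jb => ? ?; apply/andP; split; lra.
have nv : v.1 ^+ 2 + v.2 ^+ 2 = a ^+ 2 + b ^+ 2.
  rewrite bE /a.
  transitivity ((v.1 ^+ 2 + v.2 ^+ 2) * (cos m ^+ 2 + sin m ^+ 2)); last by ring.
  by rewrite cos2Dsin2 mulr1.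
rewrite /enorm nv.
rewrite -[leLHS](ger0_norm _) ?mulr_ge0 ?sqrtr_ge0 ?(ltW cd) //.
rewrite -[leRHS](ger0_norm b0) -ler_sqr ?nnegrE // !real_normK ?num_real //.
rewrite exprMn sqr_sqrtr ?addr_ge0 ?sqr_ge0 // mulrDr -!exprMn.
move: ab; have := cos2Dsin2 d; rewrite !exprMn.
move: (cos d ^+ 2) (sin d ^+ 2) (a ^+ 2) => x y z xy; move: (b ^+ 2) => w.
have -> : y = 1 - x by lra.
lra.
Qed.
End Directions.

(** * Difference quotients of continuously differentiable functions *)

Section Calculus.
Context {R : realType}.
Implicit Types (psi : R * R -> R) (x y P Q th : R * R).

Definition C1_plane psi : Prop :=
  [/\ continuous psi,
      continuous ('D_(1, 0) psi), continuous ('D_(0, 1) psi),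
      forall x, derivable psi x (1, 0) &
      forall x, derivable psi x (0, 1)].

Lemma test_function_C1 psi : test_function (basis2 R) psi -> C1_plane psi.
Proof.
move=> [sm _].
have [//|c0 d0] := sm [::].
have [|c1 _] := sm [:: (1, 0)].
  by move=> z; rewrite inE => /eqP ->; rewrite !inE eqxx.
have [|c2 _] := sm [:: (0, 1)].
  by move=> z; rewrite inE => /eqP ->; rewrite !inE eqxx orbT.
split; [exact: c0|exact: c1|exact: c2|move=> x|move=> x].
  by apply: d0; rewrite !inE eqxx.
by apply: d0; rewrite !inE eqxx orbT.
Qed.

Lemma mvt_shift (g dg : R -> R) (a : R) :
  (forall t : R, is_derive t 1 g (dg t)) ->
  exists2 s, `|s| <= `|a| & g a - g 0 = a * dg s.
Proof.
move=> gd.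
have cg : continuous g.
  by move=> t; apply: differentiable_continuous; apply/derivable1_diffP; case: (gd t).
have [a0|a0] := lerP 0 a.
  have [c] := MVT_segment a0 (fun t _ => gd t) (continuous_subspaceT cg).
  rewrite in_itv /= subr0 => /andP[c0 ca] ->; exists c; last by rewrite mulrC.
  by rewrite !ger0_norm.
have [c] := MVT_segment (ltW a0) (fun t _ => gd t) (continuous_subspaceT cg).
rewrite in_itv /= sub0r => /andP[ca c0] E; exists c.
  by rewrite (ltr0_norm a0) (ler0_norm c0) lerN2.
by rewrite -opprB E; ring.
Qed.

Lemma is_derive_fst psi x (t : R) : derivable psi (x.1 + t, x.2) (1, 0) ->
  is_derive t 1 (fun s => psi (x.1 + s, x.2)) ('D_(1, 0) psi (x.1 + t, x.2)).
Proof.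
move=> d; have E : (fun h : R => h^-1 *: (psi (x.1 + (h *: 1 + t), x.2) - psi (x.1 + t, x.2))) =
    (fun h : R => h^-1 *: (psi (h *: (1, 0) + (x.1 + t, x.2)) - psi (x.1 + t, x.2))).
  apply/funext => h; congr (_ *: (psi _ - _)); congr pair.
    by rewrite addrCA.
  by rewrite /= scaler0 add0r.
by split; rewrite /derivable /derive /= E.
Qed.

Lemma is_derive_snd psi x (t : R) : derivable psi (x.1, x.2 + t) (0, 1) ->
  is_derive t 1 (fun s => psi (x.1, x.2 + s)) ('D_(0, 1) psi (x.1, x.2 + t)).
Proof.
move=> d; have E : (fun h : R => h^-1 *: (psi (x.1, x.2 + (h *: 1 + t)) - psi (x.1, x.2 + t))) =
    (fun h : R => h^-1 *: (psi (h *: (0, 1) + (x.1, x.2 + t)) - psi (x.1, x.2 + t))).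
  apply/funext => h; congr (_ *: (psi _ - _)); congr pair.
    by rewrite /= scaler0 add0r.
  by rewrite addrCA.
by split; rewrite /derivable /derive /= E.
Qed.

(** The mean value theorem along the two sides of a coordinate rectangle; both
    intermediate points stay within [|y|] of [x] for the maximum norm. *)
Lemma C1_increment psi x y : C1_plane psi ->
  exists P Q, [/\ `|P - x| <= `|y|, `|Q - x| <= `|y| &
    psi (x + y) - psi x = y.1 * 'D_(1, 0) psi P + y.2 * 'D_(0, 1) psi Q].
Proof.
move=> [_ _ _ d1 d2].
have [s1 sy1 E1] := mvt_shift y.1
  (fun t => @is_derive_fst _ (x.1, x.2 + y.2) t (d1 _)).
have [s2 sy2 E2] := mvt_shift y.2 (fun t => is_derive_snd (d2 (x.1, x.2 + t))).
have [y1 y2] : `|y.1| <= `|y| /\ `|y.2| <= `|y|.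
  by rewrite prod_normE !le_max !lexx orbT.
have norm_le (z : R * R) (r : R) : `|z.1| <= r -> `|z.2| <= r -> `|z| <= r.
  by rewrite prod_normE ge_max => -> ->.
exists (x.1 + s1, x.2 + y.2), (x.1, x.2 + s2); split.
- by apply: norm_le => /=; rewrite addrAC subrr add0r // (le_trans sy1).
- apply: norm_le => /=; first by rewrite subrr normr0.
  by rewrite addrAC subrr add0r (le_trans sy2).
- move: E1 E2 => /=; rewrite !addr0 => E1 E2.
  rewrite -E1 -E2 [in RHS](_ : (x.1, x.2) = x); last by rewrite -surjective_pairing.
  by rewrite addrA subrK.
Qed.

Lemma continuous_bounded_box (g : R * R -> R) (M : R) : continuous g ->
  exists2 C, 0 <= C & forall x, `|x| <= M -> `|g x| <= C.
Proof.
move=> cg.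
have cI : compact (`[- M, M]%classic : set R) by exact: segment_compact.
have cB := compact_setX cI cI.
have /compact_bounded[C [Creal HC]] : compact (g @` (`[- M, M] `*` `[- M, M])).
  by apply: continuous_compact => //; exact: continuous_subspaceT.
exists (Num.max C 0 + 1); first by rewrite addr_ge0 // le_max lexx orbT.
move=> x xM; apply: HC; first by rewrite ltr_pwDr // le_max lexx.
exists x => //; move: xM; rewrite prod_normE ge_max !ler_norml /= => /andP[? ?].
by split; rewrite /= in_itv.
Qed.

End Calculus.

(** * The flux of a bounded field through a convex set *)

Section Flux.
Context {R : realType}.
Local Notation mu2 := (@lebesgue2 R).
Local Notation L1 g := (mu2.-integrable [set: plane R] (EFin \o g)).

Definition unit_dir (t : R) : R * R := (cos t, sin t).

Lemma enorm_unit_dir t : enorm (unit_dir t) = 1.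
Proof. by rewrite /enorm /= cos2Dsin2 sqrtr1. Qed.

Lemma unit_dir_periodic t : unit_dir (t + pi *+ 2) = unit_dir t.
Proof. by rewrite /unit_dir mulr2n addrA !cosDpi !sinDpi !opprK. Qed.

Lemma unit_dir_reflect t s :
  unit_dir (s *+ 2 + pi - t) = unit_dir t - (2 * cos (t - s)) *: unit_dir s.
Proof.
have [a ->] : exists a, t = a + s by exists (t - s); rewrite subrK.
rewrite addrK (_ : s *+ 2 + pi - (a + s) = s - a + pi); last by rewrite mulr2n; ring.
rewrite /unit_dir cosDpi sinDpi cosB sinB cosD sinD.
by congr pair; rewrite /= /GRing.scale /=; ring.
Qed.

Lemma enormZ (c : R) (p : R * R) : enorm (c *: p) = `|c| * enorm p.
Proof.
rewrite /enorm /= -sqrtr_sqr -sqrtrM ?sqr_ge0 //; congr Num.sqrt.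
by rewrite /GRing.scale /=; ring.
Qed.

Variables (K : set (plane R)) (D M : R) (phi : R * R -> R * R).
Hypotheses (mK : measurable K) (cK : convex_set (K : set (R * R))).
Hypotheses (D0 : 0 <= D) (KM : forall x : R * R, K x -> `|x| <= M).
Hypothesis KD : forall p q : R * R, K p -> K q -> enorm (p - q) <= D.
Hypotheses (c1 : continuous (fst \o phi)) (c2 : continuous (snd \o phi)).
Hypothesis phi1 : forall x, enorm (phi x) <= 1.

Let mphi1 : measurable_fun [set: plane R] (fun x : plane R => (phi x).1).
Proof. exact: continuous_measurable_plane. Qed.

Let mphi2 : measurable_fun [set: plane R] (fun x : plane R => (phi x).2).
Proof. exact: continuous_measurable_plane. Qed.

Let mdot (p : R * R) : measurable_fun [set: plane R] (fun x : plane R => dot (phi x) p).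
Proof. by apply: measurable_funD; apply: measurable_funM. Qed.

Lemma dot_bound (x p : R * R) : enorm p = 1 -> `|dot (phi x) p| <= 1.
Proof.
move=> p1; rewrite ler_norml; apply/andP; split; last first.
  by apply: le_trans (dot_le_enorm _ _) _; rewrite p1 mulr1.
rewrite lerNl; have -> : - dot (phi x) p = dot (- phi x) p.
  by rewrite /dot /= !mulNr opprD.
by apply: le_trans (dot_le_enorm _ _) _; rewrite p1 mulr1 enormN.
Qed.

Lemma translate_bounded (a x : R * R) : K (x - a) -> `|x| <= M + `|a|.
Proof.
by move=> /KM xM; rewrite -(subrK a x); apply: le_trans (ler_normD _ _) _; rewrite lerD2r.
Qed.

Lemma integrable_indic_translate (a : R * R) : L1 (\1_[set y | K (y - a)] : plane R -> R).
Proof.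
have -> : EFin \o (\1_[set y | K (y - a)] : plane R -> R) =
    EFin \o (fun x : plane R => \1_[set y | K (y - a)] x * (cst 1 x : R)).
  by apply/funext => x /=; rewrite mulr1.
apply: (@integrable_indic_mul _ _ _ (M + `|a|) 1) => //.
- exact: measurable_translate.
- by move=> x /= /translate_bounded.
- by move=> x _; rewrite normr1.
Qed.

Variables (l : nat) (h : R).
Hypotheses (l_gt0 : (0 < l)%N) (h_gt0 : 0 < h).
Local Notation ang := (@dir_angle R l).
Local Notation d := (dir_step R l / 2).

Let u (t : R) (y : plane R) : R := \1_[set z | K (z - h *: unit_dir t)] y.

Let du (k j : nat) (y : plane R) : R :=
  `|u (ang j) y - u (ang k *+ 2 + pi - ang j) y|.

(** With [g j] the component of [phi] along the [j]-th direction, translating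
    each integral turns the sum into the integral of [dot phi V], where [V =
    sum_j u_j theta_j] and [u_j] is the indicator of [K] moved by [h theta_j].
    Then [|phi| <= 1], [sum_abs_proj] and [sum_cos_antisym] bound the integrand
    by a combination of the functions [du k j], which [Rintegral_convex_shift]
    integrates: [theta_j] and its mirror image in the line orthogonal to
    [theta_k] are [2 |c|] apart, [c] being the cosine of the angle between
    [theta_j] and [theta_k], and the squares of these cosines sum to [2l]. *)
Lemma flux_le :
  cos d * \sum_(0 <= j < 4 * l)
    \int[mu2]_x (\1_K x * dot (phi (x + h *: unit_dir (ang j))) (unit_dir (ang j))) <=
  8 * h * D * l%:R ^+ 2 * sin d.
Proof.
have sd0 : 0 <= sin d.
  have lR : 0 < l%:R :> R by rewrite ltr0n.
  apply: sin_ge0_pi; rewrite /dir_step; apply/andP; split.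
    by rewrite !divr_ge0 ?pi_ge0 // mulr_ge0 // ltW.
  rewrite -mulrA -[leRHS]mulr1 ler_wpM2l ?pi_ge0 //.
  rewrite -invfM invf_le1 ?mulr_gt0 //.
  have : 1 <= l%:R :> R by rewrite ler1n.
  lra.
have cd0 : 0 <= cos d.
  have lR : 0 < l%:R :> R by rewrite ltr0n.
  apply: cos_ge0_pihalf; apply/andP; split.
    apply: (@le_trans _ _ 0); first by rewrite oppr_le0 divr_ge0 ?pi_ge0.
    by rewrite /dir_step !divr_ge0 ?pi_ge0 // mulr_ge0 // ltW.
  rewrite ler_pM2r // /dir_step ler_pdivrMr ?mulr_gt0 //.
  rewrite ler_peMr ?pi_ge0 //; have : 1 <= l%:R :> R by rewrite ler1n.
  lra.
pose g j (y : plane R) : R := u (ang j) y * dot (phi y) (unit_dir (ang j)).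
have ig j : L1 (g j).
  apply: (@integrable_indic_mul _ _ _ (M + `|h *: unit_dir (ang j)|) 1).
  - exact: measurable_translate.
  - by move=> x /= /translate_bounded.
  - exact: mdot.
  - by move=> x _; apply: dot_bound; exact: enorm_unit_dir.
have iu t : L1 (u t) by exact: integrable_indic_translate.
have idif t s : L1 (fun y => u t y - u s y).
  exact: (integrableB measurableT (iu t) (iu s)).
have idu k j : L1 (du k j) by exact: (integrable_norm (idif _ _)).
have idu2 k j : L1 (fun y => `|cos (ang j - ang k)| * du k j y) by exact: integrableZ_real.
have idu3 k : L1 (fun y => \sum_(0 <= j < 4 * l) `|cos (ang j - ang k)| * du k j y).
  exact: integrable_sum_real.
have idu4 : L1 (fun y => \sum_(0 <= k < 4 * l)
    \sum_(0 <= j < 4 * l) `|cos (ang j - ang k)| * du k j y).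
  exact: integrable_sum_real.
rewrite (eq_bigr (fun j => \int[mu2]_x g j x)); last first.
  move=> j _; rewrite /g /u -(@Rintegral_translate _ K (h *: unit_dir (ang j))
    (fun x => dot (phi x) (unit_dir (ang j))) M 1) //.
  by move=> x; apply: dot_bound; exact: enorm_unit_dir.
rewrite -Rintegral_sum // -RintegralZl //; last exact: integrable_sum_real.
apply: (@le_trans _ _ (\int[mu2]_y ((sin d / 4) *
    \sum_(0 <= k < 4 * l) \sum_(0 <= j < 4 * l) `|cos (ang j - ang k)| * du k j y))).
  apply: le_Rintegral => //.
  - by apply: integrableZ_real; exact: integrable_sum_real.
  - exact: integrableZ_real.
  move=> y _.
  pose V : R * R := (\sum_(0 <= j < 4 * l) u (ang j) y * cos (ang j),
                     \sum_(0 <= j < 4 * l) u (ang j) y * sin (ang j)).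
  have -> : \sum_(0 <= j < 4 * l) g j y = dot (phi y) V.
    rewrite /dot /V /= !mulr_sumr -big_split /=; apply: eq_bigr => j _.
    by rewrite /g /dot /=; ring.
  have phiV : dot (phi y) V <= enorm V.
    apply: le_trans (dot_le_enorm _ _) _.
    by rewrite ler_piMl ?enorm_ge0.
  have := sum_abs_proj l_gt0 V.
  (* Twice the projection of [V] on the [k]-th direction. *)
  have VE k : 2 * `|V.1 * cos (ang k) + V.2 * sin (ang k)| <=
      \sum_(0 <= j < 4 * l) `|cos (ang j - ang k)| * du k j y.
    rewrite -[2 in leLHS](@ger0_norm R) // -normrM.
    have -> : V.1 * cos (ang k) + V.2 * sin (ang k) =
        \sum_(0 <= j < 4 * l) cos (ang j - ang k) * u (ang j) y.
      rewrite /V /= !mulr_suml -big_split /=; apply: eq_bigr => j _.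
      rewrite cosB; ring.
    rewrite (@sum_cos_antisym R l l_gt0 k (fun t => u t y)); last first.
      by move=> t; rewrite /u unit_dir_periodic.
    by apply: le_trans (ler_norm_sum _ _ _) _; apply: ler_sum => j _; rewrite normrM.
  have : \sum_(0 <= k < 4 * l) (2 * `|V.1 * cos (ang k) + V.2 * sin (ang k)|) <=
      \sum_(0 <= k < 4 * l) \sum_(0 <= j < 4 * l) `|cos (ang j - ang k)| * du k j y.
    by apply: ler_sum => k _; exact: VE.
  rewrite -mulr_sumr.
  set S := \sum_(_ <= _ < _) `|_|; set T := \sum_(_ <= _ < _) _.
  have := ler_wpM2l cd0 phiV.
  move: (enorm V) => e H1 H2 H3.
  have : sin d * (2 * S) <= sin d * T by rewrite ler_wpM2l.
  lra.
rewrite RintegralZl // Rintegral_sum //.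
have bd k : \int[mu2]_x (\sum_(0 <= j < 4 * l) `|cos (ang j - ang k)| * du k j x) <=
    8 * h * D * l%:R.
  rewrite Rintegral_sum //.
  apply: (@le_trans _ _ (\sum_(0 <= j < 4 * l) (4 * h * D) * cos (ang j - ang k) ^+ 2)).
    apply: ler_sum => j _; rewrite RintegralZl //.
    set c := cos _.
    have := @Rintegral_convex_shift R K D M (h *: unit_dir (ang j))
      (h *: unit_dir (ang k *+ 2 + pi - ang j)) mK cK D0 KM KD.
    have -> : enorm (h *: unit_dir (ang j) - h *: unit_dir (ang k *+ 2 + pi - ang j)) = 2 * h * `|c|.
      rewrite unit_dir_reflect -scalerBr opprB addrCA subrr addr0 scalerA enormZ.
      by rewrite enorm_unit_dir mulr1 !normrM (gtr0_norm h_gt0) ger0_norm // -/c; ring.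
    move=> H.
    have := ler_wpM2l (normr_ge0 c) H.
    rewrite (_ : `|c| * (2 * _) = 4 * h * D * `|c| ^+ 2); last by ring.
    by rewrite real_normK ?num_real.
  rewrite -mulr_sumr sum_cos2_ang // le_eqVlt; apply/orP; left; apply/eqP; ring.
apply: (@le_trans _ _ (sin d / 4 * \sum_(0 <= k < 4 * l) (8 * h * D * l%:R))).
  by rewrite ler_wpM2l ?divr_ge0 //; apply: ler_sum => k _; exact: bd.
rewrite sumr_const_nat subn0 -(mulr_natr (8 * h * D * l%:R)) natrM.
rewrite le_eqVlt; apply/orP; left; apply/eqP; by field.
Qed.
End Flux.

Section FluxLimit.
Context {R : realType}.
Local Notation mu2 := (@lebesgue2 R).
Local Notation L1 g := (mu2.-integrable [set: plane R] (EFin \o g)).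
Local Notation D1 psi := ('D_((1, 0) : R * R) psi).
Local Notation D2 psi := ('D_((0, 1) : R * R) psi).

Lemma cvg_near_point (x : R * R) (c : R) (P : nat -> R * R) :
  (forall n, `|P n - x| <= n.+1%:R^-1 * c) -> P n @[n --> \oo] --> x.
Proof.
move=> Px; apply/cvgrPdist_le => e e0.
have : (n.+1%:R^-1 * c) @[n --> \oo] --> (0 * c : R).
  by apply: cvgMr_tmp; exact: cvg_harmonic.
rewrite mul0r => /cvgrPdist_le /(_ e e0); apply: filterS => n.
rewrite sub0r normrN distrC => nc; apply: le_trans (Px n) _.
exact: le_trans (ler_norm _) nc.
Qed.

Lemma C1_quotient_cvg (psi : R * R -> R) (x y : R * R) : C1_plane psi ->
  n.+1%:R * (psi (x + n.+1%:R^-1 *: y) - psi x) @[n --> \oo] -->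
    y.1 * D1 psi x + y.2 * D2 psi x.
Proof.
move=> C; have [_ cd1 cd2 _ _] := C.
have /choice[PQ PQP] : forall n : nat, exists pq : (R * R) * (R * R),
   [/\ `|pq.1 - x| <= n.+1%:R^-1 * `|y|, `|pq.2 - x| <= n.+1%:R^-1 * `|y| &
   n.+1%:R * (psi (x + n.+1%:R^-1 *: y) - psi x) = y.1 * D1 psi pq.1 + y.2 * D2 psi pq.2].
  move=> n; have [P [Q [HP HQ E]]] := C1_increment x (n.+1%:R^-1 *: y) C.
  exists (P, Q); move: HP HQ; rewrite normrZ ger0_norm ?invr_ge0 // => HP HQ.
  split => //=; rewrite E /= /GRing.scale /= mulrDr.
  by rewrite !mulrA divff ?pnatr_eq0 // !mul1r.
rewrite (_ : (fun n => _) = (fun n => y.1 * D1 psi (PQ n).1 + y.2 * D2 psi (PQ n).2)); last first.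
  by apply/funext => n; have [_ _ ->] := PQP n.
have P1 : (PQ n).1 @[n --> \oo] --> x.
  by apply: (@cvg_near_point _ `|y|) => n; have [] := PQP n.
have P2 : (PQ n).2 @[n --> \oo] --> x.
  by apply: (@cvg_near_point _ `|y|) => n; have [] := PQP n.
apply: cvgD; apply: cvgMl_tmp.
- exact: (cvg_comp _ _ P1 (cd1 x)).
- exact: (cvg_comp _ _ P2 (cd2 x)).
Qed.

Lemma C1_quotient_bound (psi : R * R -> R) (M : R) : C1_plane psi ->
  exists2 C, 0 <= C & forall n x y, `|x| <= M -> `|y| <= 1 ->
   `|n.+1%:R * (psi (x + n.+1%:R^-1 *: y) - psi x)| <= C.
Proof.
move=> C; have [_ cd1 cd2 _ _] := C.
have [C1 C10 H1] := continuous_bounded_box (M + 1) cd1.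
have [C2 C20 H2] := continuous_bounded_box (M + 1) cd2.
exists (C1 + C2); first by rewrite addr_ge0.
move=> n x y xM y1.
have [P [Q [HP HQ E]]] := C1_increment x (n.+1%:R^-1 *: y) C.
have ny : `|n.+1%:R^-1 *: y| <= 1.
  rewrite normrZ ger0_norm ?invr_ge0 // mulr_ile1 ?invr_ge0 //.
  by rewrite invf_le1 ?ltr0n // ler1n.
have near z : `|z - x| <= `|n.+1%:R^-1 *: y| -> `|z| <= M + 1.
  move=> zx; rewrite -(subrK x z) addrC; apply: le_trans (ler_normD _ _) _.
  by apply: lerD => //; exact: le_trans zx ny.
rewrite E /= /GRing.scale /= -!mulrA -mulrDr mulrA divff ?pnatr_eq0 // mul1r.
apply: le_trans (ler_normD _ _) _; rewrite !normrM.
have [y11 y21] : `|y.1| <= 1 /\ `|y.2| <= 1.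
  by move: y1; rewrite prod_normE ge_max => /andP[].
apply: lerD.
- by rewrite -(mul1r C1) ler_pM // H1 // near.
- by rewrite -(mul1r C2) ler_pM // H2 // near.
Qed.

Lemma cvg_sum_nat (F : nat -> nat -> R) (L : nat -> R) (m : nat) :
  (forall j, F j n @[n --> \oo] --> L j) ->
  \sum_(0 <= j < m) F j n @[n --> \oo] --> \sum_(0 <= j < m) L j.
Proof.
move=> FL; elim: m => [|m IH].
  rewrite big_geq //; under eq_fun do rewrite big_geq //; exact: cvg_cst.
rewrite big_nat_recr //=; under eq_fun do rewrite big_nat_recr //=.
exact: cvgD.
Qed.

Lemma sin_le_id (x : R) : 0 <= x -> sin x <= x.
Proof.
move=> x0; have [s _ E] := mvt_shift x (fun t : R => is_derive_sin t).
move: E; rewrite sin0 subr0 => ->.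
by rewrite -[leRHS]mulr1 ler_wpM2l // cos_le1.
Qed.

Variables (K : set (plane R)) (D M : R) (phi : R * R -> R * R).
Hypotheses (mK : measurable K) (cK : convex_set (K : set (R * R))).
Hypotheses (D0 : 0 <= D) (KM : forall x : R * R, K x -> `|x| <= M).
Hypothesis KD : forall p q : R * R, K p -> K q -> enorm (p - q) <= D.
Hypotheses (c1 : C1_plane (fst \o phi)) (c2 : C1_plane (snd \o phi)).
Hypothesis phi1 : forall x, enorm (phi x) <= 1.

Let div (x : R * R) : R := D1 (fst \o phi) x + D2 (snd \o phi) x.

Lemma measurable_divergence : measurable_fun [set: plane R] (div : plane R -> R).
Proof.
have [_ cd1 _ _ _] := c1; have [_ _ cd2 _ _] := c2.
by apply: measurable_funD; exact: continuous_measurable_plane.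
Qed.

Lemma integrable_indic_divergence : L1 (fun x => \1_K x * div x).
Proof.
have [_ cd1 _ _ _] := c1; have [_ _ cd2 _ _] := c2.
have [C1 _ H1] := continuous_bounded_box M cd1.
have [C2 _ H2] := continuous_bounded_box M cd2.
apply: (@integrable_indic_mul _ _ _ M (C1 + C2)) => //; first exact: measurable_divergence.
move=> x /KM xM; apply: le_trans (ler_normD _ _) _.
by apply: lerD; [exact: H1|exact: H2].
Qed.

Section FixedDirections.
Variable l : nat.
Hypothesis l_gt0 : (0 < l)%N.
Local Notation ang := (@dir_angle R l).

(* The [theta_j] sum to zero, so subtracting [phi x] changes nothing in the sum
   and makes difference quotients appear. *)
Let q (n : nat) (x : R * R) : R := \sum_(0 <= j < 4 * l)
   n.+1%:R * dot (phi (x + n.+1%:R^-1 *: unit_dir (ang j)) - phi x) (unit_dir (ang j)).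

Let norm_unit_dir t : `|unit_dir t : R * R| <= 1.
Proof. by rewrite prod_normE ge_max /= cos_max sin_max. Qed.

Let dotE n x t : n.+1%:R * dot (phi (x + n.+1%:R^-1 *: unit_dir t) - phi x) (unit_dir t) =
  cos t * (n.+1%:R * ((fst \o phi) (x + n.+1%:R^-1 *: unit_dir t) - (fst \o phi) x)) +
  sin t * (n.+1%:R * ((snd \o phi) (x + n.+1%:R^-1 *: unit_dir t) - (snd \o phi) x)).
Proof. by rewrite /dot /=; ring. Qed.

Let q_cvg x : q n x @[n --> \oo] --> 2 * l%:R * div x.
Proof.
rewrite (_ : 2 * l%:R * div x = \sum_(0 <= j < 4 * l)
   (cos (ang j) * (cos (ang j) * D1 (fst \o phi) x + sin (ang j) * D2 (fst \o phi) x) +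
    sin (ang j) * (cos (ang j) * D1 (snd \o phi) x + sin (ang j) * D2 (snd \o phi) x))).
  apply: cvg_sum_nat => j; under eq_fun do rewrite dotE.
  by apply: cvgD; apply: cvgMl_tmp; exact: (@C1_quotient_cvg _ x (unit_dir (ang j))).
have sc2 : \sum_(0 <= j < 4 * l) cos (ang j) ^+ 2 = 2 * l%:R.
  by rewrite -(sum_cos2_ang l_gt0 (0 : R)); apply: eq_bigr => j _; rewrite subr0.
have ss2 : \sum_(0 <= j < 4 * l) sin (ang j) ^+ 2 = 2 * l%:R.
  rewrite -(sum_cos2_ang l_gt0 (pi / 2 : R)); apply: eq_bigr => j _.
  by rewrite cosBpihalf.
rewrite (eq_bigr (fun j => cos (ang j) ^+ 2 * D1 (fst \o phi) x +
   sin (ang j) ^+ 2 * D2 (snd \o phi) x +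
   (cos (ang j) * sin (ang j)) * (D2 (fst \o phi) x + D1 (snd \o phi) x))); last first.
  by move=> j _; ring.
rewrite !big_split /= -!mulr_suml sc2 ss2 sum_cossin_ang // mul0r addr0 /div.
by rewrite mulrDr.
Qed.

Let q_bound : exists2 C, 0 <= C & forall n (x : R * R), `|x| <= M -> `|q n x| <= C.
Proof.
have [C1 C10 H1] := C1_quotient_bound M c1.
have [C2 C20 H2] := C1_quotient_bound M c2.
exists (\sum_(0 <= j < 4 * l) (C1 + C2)); first by apply: sumr_ge0 => j _; rewrite addr_ge0.
move=> n x xM; apply: le_trans (ler_norm_sum _ _ _) _; apply: ler_sum => j _.
rewrite dotE; apply: le_trans (ler_normD _ _) _; rewrite !(normrM (_ (ang j))).
apply: lerD.
- by rewrite -(mul1r C1) ler_pM ?cos_max // H1.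
- by rewrite -(mul1r C2) ler_pM ?sin_max // H2.
Qed.

Let mq n : measurable_fun [set: plane R] (q n : plane R -> R).
Proof.
have [cp1 _ _ _ _] := c1; have [cp2 _ _ _ _] := c2.
apply: continuous_measurable_plane.
have -> : q n = (fun x => \sum_(0 <= j < 4 * l)
  (cos (ang j) * (n.+1%:R * ((fst \o phi) (x + n.+1%:R^-1 *: unit_dir (ang j)) - (fst \o phi) x)) +
  sin (ang j) * (n.+1%:R * ((snd \o phi) (x + n.+1%:R^-1 *: unit_dir (ang j)) - (snd \o phi) x)))).
  by apply/funext => x; apply: eq_bigr => j _; rewrite dotE.
have csh (psi : R * R -> R) (a : R * R) : continuous psi -> continuous (fun x : R * R => psi (x + a)).
  move=> cpsi x; apply: (@continuous_comp _ _ _ (fun x : R * R => x + a) psi); last exact: cpsi.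
  by apply: cvgD => //; exact: cvg_cst.
elim: (4 * l)%N => [|m IH] x.
  under eq_fun do rewrite big_geq //; exact: cvg_cst.
under eq_fun do rewrite big_nat_recr //=.
apply: cvgD; first exact: IH.
apply: cvgD; apply: cvgMl_tmp; apply: cvgMl_tmp; apply: cvgB.
- exact: (csh _ _ cp1).
- exact: cp1.
- exact: (csh _ _ cp2).
- exact: cp2.
Qed.

Let flux (n : nat) : R := \sum_(0 <= j < 4 * l)
    \int[mu2]_x (\1_K x * dot (phi (x + n.+1%:R^-1 *: unit_dir (ang j))) (unit_dir (ang j))).

(** Dominated convergence. Pointwise, the difference quotients tend to
    directional derivatives, and the sum of the derivatives of [theta_j . phi]
    along [theta_j] is [2l] times the divergence because of [sum_cos2_ang] and
    [sum_cossin_ang]. *)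
Lemma flux_cvg : n.+1%:R * flux n @[n --> \oo] -->
  2 * l%:R * \int[mu2]_x (\1_K x * div x).
Proof.
have [C C0 qC] := q_bound.
have [cp1 _ _ _ _] := c1; have [cp2 _ _ _ _] := c2.
have iq n : L1 (fun x : R * R => \1_K x * q n x).
  by apply: (@integrable_indic_mul _ _ _ M C) => // x /KM; exact: qC.
have fluxE n : n.+1%:R * flux n = \int[mu2]_x (\1_K x * q n x).
  have ij j : L1 (fun x : R * R => \1_K x *
      dot (phi (x + n.+1%:R^-1 *: unit_dir (ang j))) (unit_dir (ang j))).
    apply: (@integrable_indic_mul _ _ _ M 1) => //; last first.
      by move=> x _; apply: dot_bound => //; exact: enorm_unit_dir.
    have mt : measurable_fun [set: plane R]
        ((fun x : R * R => x + n.+1%:R^-1 *: unit_dir (ang j)) : plane R -> plane R).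
      apply: measurable_fun_pair.
        exact: (measurableT_comp (measurable_shift _)).
      exact: (measurableT_comp (measurable_shift _)).
    apply: measurable_funD; apply: measurable_funM => //.
      exact: (measurableT_comp (continuous_measurable_plane cp1) mt).
    exact: (measurableT_comp (continuous_measurable_plane cp2) mt).
  rewrite /flux -Rintegral_sum // -RintegralZl //; last exact: integrable_sum_real.
  apply: eq_Rintegral => x _; rewrite -mulr_sumr mulrCA; congr (_ * _).
  rewrite /q -mulr_sumr; congr (_ * _).
  rewrite [RHS](eq_bigr (fun j => dot (phi (x + n.+1%:R^-1 *: unit_dir (ang j))) (unit_dir (ang j)) -
    ((phi x).1 * cos (ang j) + (phi x).2 * sin (ang j)))); last first.
    by move=> j _; rewrite /dot /=; ring.
  rewrite [RHS]big_split /= sumrN [X in _ = _ - X]big_split /= -!mulr_sumr sum_cos_ang // sum_sin_ang //.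
  by rewrite !mulr0 addr0 subr0.
under eq_fun do rewrite fluxE.
pose F n (x : plane R) := (\1_K x * q n x)%:E.
pose F0 (x : plane R) := (2 * l%:R * (\1_K x * div x))%:E.
pose G (x : plane R) := (\1_K x * C)%:E.
have [] := @dominated_convergence _ _ _ mu2 setT measurableT F F0 G.
- by move=> n; have /integrableP[] := iq n.
- by have /integrableP[] := integrableZ_real (2 * l%:R) integrable_indic_divergence.
- apply: aeW => x _; rewrite /F /F0 mulrCA; apply: cvg_EFin; first exact: nearW.
  by apply: cvgMl_tmp; exact: q_cvg.
- apply: (@integrable_indic_mul _ _ (cst C) M C) => //.
  by move=> x _; rewrite ger0_norm.
- apply: aeW => x n _; rewrite /F /G lee_fin indicE.
  case: (boolP (x \in K)) => [|_]; last by rewrite !mul0r normr0.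
  by rewrite inE => /KM xM; rewrite !mul1r; exact: qC.
move=> iF0 _ cvgF.
rewrite -RintegralZl //; last exact: integrable_indic_divergence.
rewrite /Rintegral; apply: fine_cvg.
rewrite fineK; first exact: cvgF.
exact: integrable_fin_num.
Qed.

(** [flux_le] and [flux_cvg] give [2l cos d I <= 8 D l^2 sin d] with [d = pi /
    4l], and [sin d <= d]. *)
Lemma divergence_bound_directions :
  cos (pi / (4 * l%:R)) * \int[mu2]_x (\1_K x * div x) <= pi * D.
Proof.
have [cp1 _ _ _ _] := c1; have [cp2 _ _ _ _] := c2.
have lR : 0 < l%:R :> R by rewrite ltr0n.
set d := pi / (4 * l%:R); set I := Rintegral _ _ _.
have dE : dir_step R l / 2 = d by rewrite /dir_step /d; field; rewrite gt_eqF.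
have lim : cos d * (n.+1%:R * flux n) @[n --> \oo] --> cos d * (2 * l%:R * I).
  by apply: cvgMl_tmp; exact: flux_cvg.
have : cos d * (2 * l%:R * I) <= 8 * D * l%:R ^+ 2 * sin d.
  apply: (cvgr_to_le lim); apply: nearW => n.
  have n0 : 0 < n.+1%:R^-1 :> R by rewrite invr_gt0.
  have := flux_le mK cK D0 KM KD cp1 cp2 phi1 l_gt0 n0; rewrite dE => H.
  rewrite mulrCA; apply: le_trans (ler_wpM2l (ler0n _ n.+1) H) _.
  have : n.+1%:R != 0 :> R by rewrite pnatr_eq0.
  by move: n.+1%:R => r r0; rewrite le_eqVlt; apply/orP; left; apply/eqP; field.
have d0 : 0 <= d by rewrite /d divr_ge0 ?pi_ge0 // mulr_ge0 // ltW.
have := sin_le_id d0.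
have -> : pi * D = 4 * l%:R * d * D by rewrite /d; field; rewrite gt_eqF.
move=> sdd H.
rewrite -(@ler_pM2l _ (2 * l%:R)) ?mulr_gt0 //.
rewrite mulrCA; apply: le_trans H _.
have -> : 2 * l%:R * (4 * l%:R * d * D) = (8 * D * l%:R ^+ 2) * d by ring.
by rewrite ler_wpM2l // !mulr_ge0 // sqr_ge0.
Qed.
End FixedDirections.

(** A convex set of diameter at most [D] has perimeter at most [pi D], stated
    as a bound on the flux of fields of norm at most 1. *)
Lemma convex_divergence_bound :
  \int[mu2]_x (\1_K x * div x) <= pi * D.
Proof.
set I := Rintegral _ _ _.
have : cos (pi / 4 * n.+1%:R^-1) * I @[n --> \oo] --> cos (pi / 4 * 0) * I.
  have c0 : pi / 4 * n.+1%:R^-1 @[n --> \oo] --> pi / 4 * (0 : R).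
    by apply: cvgMl_tmp; exact: cvg_harmonic.
  by apply: cvgMr_tmp; exact: (cvg_comp _ _ c0 (@continuous_cos R _)).
rewrite mulr0 cos0 mul1r => lim; apply: (cvgr_to_le lim); apply: nearW => n.
have := @divergence_bound_directions n.+1 (ltn0Sn _).
by rewrite invfM mulrA.
Qed.
End FluxLimit.

(** * Smooth steps on the line *)

Section SmoothFunctions.
Context {R : realType}.
Implicit Types (f g : R -> R).

(** [exp (-1/x)] divided by [x ^ n], extended by 0: derivation maps these
    functions to linear combinations of one another. *)
Definition flat (n : nat) (x : R) : R :=
  if 0 < x then x^-1 ^+ n * expR (- x^-1) else 0.

Lemma flat_le0 n x : x <= 0 -> flat n x = 0.
Proof. by rewrite /flat leNgt => /negbTE ->. Qed.

Lemma flat_ge0 n x : 0 <= flat n x.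
Proof.
rewrite /flat; case: ifPn => // x0.
by rewrite mulr_ge0 ?expR_ge0 // exprn_ge0 // invr_ge0 ltW.
Qed.

Lemma flat_gt0 x : 0 < x -> 0 < flat 0 x.
Proof. by rewrite /flat => ->; rewrite expr0 mul1r expR_gt0. Qed.

(** With [t = 1 / x] this is [t ^ (n + 2) <= (n + 2)! exp t], and it yields the
    derivative at 0. *)
Lemma flat_quadratic n x : flat n x <= n.+2`!%:R * x ^+ 2.
Proof.
have [x0|x0] := lerP x 0; first by rewrite flat_le0 // mulr_ge0 ?sqr_ge0.
rewrite /flat x0; set t := x^-1.
have t0 : 0 < t by rewrite invr_gt0.
have xE : x ^+ 2 = t ^- 2 by rewrite /t exprVn invrK.
rewrite xE -ler_pdivrMr ?invr_gt0 ?exprn_gt0 // invrK mulrAC -exprD addn2 expRN.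
rewrite ler_pdivrMr ?expR_gt0 // mulrC -ler_pdivrMr ?ltr0n ?fact_gt0 //.
have := @expR_ge1Dxn R t n.+1 (ltW t0).
by apply: le_trans; rewrite lerDr.
Qed.

Lemma is_derive_flat n (x : R) :
  is_derive x 1 (flat n) (- n%:R * flat n.+1 x + flat n.+2 x).
Proof.
have [x0|x0|->] := ltrgtP x 0.
- rewrite !flat_le0 ?ltW // mulr0 addr0.
  refine (@near_eq_is_derive _ _ _ (cst 0) _ _ _ _ _ (is_derive_cst _ _ _)).
  by near=> y; rewrite flat_le0 //; near: y; exact: lt_le_nbhsl.
- apply: (@near_eq_is_derive _ _ _ (fun y : R => y^-1 ^+ n * expR (- y^-1) : R)).
    by near=> y; rewrite /flat ifT //; near: y; exact: lt_nbhsr.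
  have xN0 : x != 0 by rewrite gt_eqF.
  have dV : is_derive x 1 (fun y : R => y^-1) (- x ^- 2).
    have := is_deriveV xN0 (is_derive_id x (1 : R)).
    by rewrite /GRing.scale /= mulr1.
  have dN : is_derive x 1 (fun y : R => - y^-1) (x ^- 2).
    by have := is_deriveN dV; rewrite opprK.
  have dE : is_derive x 1 (fun y : R => expR (- y^-1)) (expR (- x^-1) * x ^- 2).
    exact: (is_derive1_comp (is_derive_expR _) dN).
  have := is_deriveX n dV; rewrite exprfctE => dX.
  apply: (@is_derive_eq _ _ _ _ _ _ _ _ (is_deriveM dX dE)).
  rewrite /flat x0.
  rewrite /GRing.scale /= -!exprVn.
  case: n dX => [|n] _; first by rewrite !expr0 !mulr0n !mul0r mulr0 oppr0 mul0r addr0 add0r mul1r mulrC.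
  rewrite /= -mulr_natr !exprS; ring.
rewrite !flat_le0 // mulr0 addr0.
have lim : h^-1 *: (flat n (h *: 1 + 0) - flat n 0) @[h --> (0 : R)^'] --> (0 : R).
  apply/cvgrPdist_le => e e0.
  have C0 : 0 < n.+2`!%:R :> R by rewrite ltr0n fact_gt0.
  near=> h.
  have hN0 : h != 0 by near: h; exact: nbhs_dnbhs_neq.
  rewrite sub0r normrN (flat_le0 n (lexx 0)) subr0 addr0 /GRing.scale /= mulr1.
  rewrite normrM normfV (ger0_norm (flat_ge0 _ _)) ler_pdivrMl ?normr_gt0 //.
  apply: le_trans (flat_quadratic _ _) _.
  rewrite -(real_normK (num_real h)) expr2 mulrCA ler_pM2l ?normr_gt0 //.
  rewrite -ler_pdivlMl //; near: h.
  have : \forall h \near (0 : R), `|0 - h| < n.+2`!%:R^-1 * e.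
    by exists (n.+2`!%:R^-1 * e) => //=; rewrite mulr_gt0 ?invr_gt0.
  by move=> /nbhs_dnbhs; apply: filterS => h; rewrite sub0r normrN => /ltW.
exact: (DeriveDef (cvgP _ lim) (cvg_lim _ lim)).
Unshelve. all: by end_near.
Qed.

(** A class of functions that is stable under derivation by construction, so
    that smoothness needs no computation of iterated derivatives. *)
Inductive smooth_closure : (R -> R) -> Prop :=
| SC_flat n : smooth_closure (flat n)
| SC_cst c : smooth_closure (cst c)
| SC_add f g : smooth_closure f -> smooth_closure g ->
    smooth_closure (fun x => f x + g x)
| SC_mul f g : smooth_closure f -> smooth_closure g ->
    smooth_closure (fun x => f x * g x)
| SC_affine a b f : smooth_closure f -> smooth_closure (fun x => f (a * x + b))
| SC_inv f : (forall x, f x != 0) -> smooth_closure f ->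
    smooth_closure (fun x => (f x)^-1).

Lemma is_derive_affine (a b x : R) : is_derive x 1 (fun y : R => a * y + b) a.
Proof.
apply: (@is_derive_eq _ _ _ _ _ _ _ _
  (is_deriveD (is_deriveZ a (is_derive_id x (1 : R))) (is_derive_cst b x (1 : R)))).
by rewrite /GRing.scale /= mulr1 addr0.
Qed.

Lemma smooth_closure_derive f : smooth_closure f ->
  exists2 g, smooth_closure g & forall x : R, is_derive x 1 f (g x).
Proof.
elim=> {f} [n|c|f g _ [f' sf' df] _ [g' sg' dg]|f g sf [f' sf' df] sg [g' sg' dg]
  |a b f _ [f' sf' df]|f fN0 sf [f' sf' df]].
- exists (fun x => cst (- n%:R) x * flat n.+1 x + flat n.+2 x).
    by apply: SC_add; [apply: SC_mul; [exact: SC_cst|]|]; exact: SC_flat.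
  by move=> x; exact: is_derive_flat.
- by exists (cst 0); [exact: SC_cst|move=> x; exact: is_derive_cst].
- exists (fun x => f' x + g' x); first exact: SC_add.
  by move=> x; exact: is_deriveD.
- exists (fun x => f x * g' x + g x * f' x).
    by apply: SC_add; apply: SC_mul.
  by move=> x; exact: is_deriveM.
- exists (fun x => f' (a * x + b) * cst a x).
    by apply: SC_mul; [exact: SC_affine|exact: SC_cst].
  by move=> x; exact: (is_derive1_comp (df _) (is_derive_affine a b x)).
- exists (fun x => (cst (-1) x * ((f x)^-1 * (f x)^-1)) * f' x).
    apply: SC_mul => //; apply: SC_mul; first exact: SC_cst.
    by apply: SC_mul; exact: SC_inv.
  move=> x; apply: (@is_derive_eq _ _ _ _ _ _ _ _ (is_deriveV (fN0 x) (df x))).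
  by rewrite /GRing.scale /= mulN1r -exprVn expr2.
Qed.

Lemma smooth_closure_derivable f (x : R) : smooth_closure f -> derivable f x 1.
Proof. by move=> /smooth_closure_derive[g _ /(_ x)[]]. Qed.

Lemma smooth_closure_continuous f : smooth_closure f -> continuous f.
Proof.
move=> sf x; apply: differentiable_continuous; apply/derivable1_diffP.
exact: smooth_closure_derivable.
Qed.

Lemma smooth_closure_smooth f : smooth_closure f -> smooth (basis1 R) f.
Proof.
move=> sf s.
suff iter : {subset s <= basis1 R} -> smooth_closure (iter_derive s f).
  move=> /iter si; split; first exact: smooth_closure_continuous.
  by move=> x v; rewrite inE => /eqP ->; exact: smooth_closure_derivable.
elim: s => [//|v s IH] vs.
have /eqP -> : v == 1 by have := vs v; rewrite !inE eqxx => /(_ isT).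
have [|g sg dg] := @smooth_closure_derive (iter_derive s f).
  by apply: IH => z zs; apply: vs; rewrite inE zs orbT.
rewrite (_ : iter_derive _ _ = g) //; apply/funext => x /=.
by have [_] := dg x.
Qed.
End SmoothFunctions.

Section SmoothStep.
Context {R : realType}.
Local Notation mu := (@lebesgue_measure R).

(** A smooth transition from 0 on the negative axis to 1 beyond 1. *)
Definition smooth_step (x : R) : R := flat 0 x / (flat 0 x + flat 0 (1 - x)).

Lemma smooth_step_denom_gt0 (x : R) : 0 < flat 0 x + flat 0 (1 - x).
Proof.
have [x0|x0] := ltrP 0 x; first by rewrite ltr_pwDl ?flat_gt0 ?flat_ge0.
by rewrite ltr_pwDr ?flat_ge0 // flat_gt0 //; lra.
Qed.

Lemma smooth_closure_step : smooth_closure smooth_step.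
Proof.
have s1 : smooth_closure (fun x : R => flat 0 (1 - x)).
  have -> : (fun x : R => flat 0 (1 - x)) = (fun x => flat 0 (-1 * x + 1)).
    by apply/funext => x; congr flat; ring.
  exact: SC_affine (SC_flat 0).
apply: SC_mul; first exact: SC_flat.
apply: SC_inv; last exact: SC_add (SC_flat 0) s1.
by move=> x; rewrite gt_eqF // smooth_step_denom_gt0.
Qed.

Lemma smooth_step_le0 x : x <= 0 -> smooth_step x = 0.
Proof. by move=> x0; rewrite /smooth_step flat_le0 // mul0r. Qed.

Lemma smooth_step_ge1 x : 1 <= x -> smooth_step x = 1.
Proof.
move=> x1; rewrite /smooth_step (@flat_le0 _ _ (1 - x)) ?subr_le0 // addr0.
by rewrite divff // gt_eqF // flat_gt0 //; lra.
Qed.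

Lemma smooth_step_01 x : 0 <= smooth_step x <= 1.
Proof.
have d0 := smooth_step_denom_gt0 x.
rewrite /smooth_step divr_ge0 ?flat_ge0 ?(ltW d0) //=.
by rewrite ler_pdivrMr // mul1r lerDl flat_ge0.
Qed.

Lemma derive_smooth_step (x : R) : 'D_1 smooth_step x =
  (flat 2 x * flat 0 (1 - x) + flat 0 x * flat 2 (1 - x)) / (flat 0 x + flat 0 (1 - x)) ^+ 2.
Proof.
have d0 : flat 0 x + flat 0 (1 - x) != 0 by rewrite gt_eqF // smooth_step_denom_gt0.
have dF (y : R) : is_derive y 1 (flat 0) (flat 2 y).
  by apply: (is_derive_eq (is_derive_flat 0 y)); rewrite oppr0 mul0r add0r.
have dA : is_derive x 1 (fun y : R => 1 - y) (-1).
  have -> : (fun y : R => 1 - y) = (fun y => -1 * y + 1) by apply/funext => y; ring.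
  exact: is_derive_affine.
have dG : is_derive x 1 (fun y : R => flat 0 (1 - y)) (flat 2 (1 - x) * -1).
  exact: (@is_derive1_comp _ (flat 0) (fun y => 1 - y) x _ _ (dF _) dA).
have dD := is_deriveD (dF x) dG.
have dS := is_deriveM (dF x) (is_deriveV (d0 : (flat 0 + (fun y => flat 0 (1 - y))) x != 0) dD).
have [_ ->] : is_derive x 1 smooth_step _ := dS.
rewrite /GRing.scale /=; change ((flat 0 + (fun y => flat 0 (1 - y))) x) with (flat 0 x + flat 0 (1 - x)).
by field.
Qed.

Lemma derive_smooth_step_ge0 (x : R) : 0 <= 'D_1 smooth_step x.
Proof.
by rewrite derive_smooth_step divr_ge0 ?sqr_ge0 // addr_ge0 // mulr_ge0 // flat_ge0.
Qed.

Lemma derive_smooth_step_out (x : R) : ~~ (0 < x < 1) -> 'D_1 smooth_step x = 0.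
Proof.
rewrite derive_smooth_step => xN.
have [x0|x0] := lerP x 0; first by rewrite !(flat_le0 _ x0) !mul0r addr0 mul0r.
have x1 : 1 - x <= 0 by move: xN; rewrite x0 /= -leNgt; lra.
by rewrite !(flat_le0 _ x1) !mulr0 addr0 mul0r.
Qed.

Lemma smooth_closure_derive_step : smooth_closure ('D_1 smooth_step).
Proof.
have [g sg dg] := smooth_closure_derive smooth_closure_step.
by rewrite (_ : 'D_1 smooth_step = g) //; apply/funext => x; have [] := dg x.
Qed.

(** * A lower bound for the variation of a function of one variable *)

Lemma integral_smooth_closure (f F : R -> R) (a b : R) : a < b ->
  smooth_closure f -> smooth_closure F -> (forall x : R, is_derive x 1 F (f x)) ->
  (\int[mu]_(x in `[a, b]) (f x)%:E = (F b)%:E - (F a)%:E)%E.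
Proof.
move=> ab sf sF dF; apply: continuous_FTC2 => //.
- exact/continuous_subspaceT/smooth_closure_continuous.
- split.
  + by move=> x _; exact: smooth_closure_derivable.
  + by apply: cvg_at_right_filter; exact: smooth_closure_continuous.
  + by apply: cvg_at_left_filter; exact: smooth_closure_continuous.
- by move=> x _; rewrite derive1E; have [] := dF x.
Qed.

(** The test function [phi] goes from 0 down to -1 far on the left, up to 1
    across [[a, b]], and down to 0 far on the right. The two outer transitions
    take place where [g] vanishes, so that [g phi'] is [2 g] times the
    derivative of a step across [[a, b]], whose integral is 1. *)
Lemma TV1_ge (g : R -> R) (B a b m : R) :
  measurable_fun [set: measurableTypeR R] (g : measurableTypeR R -> R) ->
  (forall x, 0 <= g x) -> (forall x, B < `|x| -> g x = 0) ->
  a < b -> 0 <= m -> (forall x, a <= x <= b -> m <= g x) ->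
  ((2 * m)%:E <= TV1 g)%E.
Proof.
move=> mg g0 gB ab m0 gm.
pose L := b - a; have L0 : 0 < L by rewrite subr_gt0.
have LN0 : L != 0 by rewrite gt_eqF.
pose x3 := `|B| + `|a| + `|b| + 1.
pose x1 := - x3 - L.
have [a1 b1 B1] : [/\ - `|a| <= a, b <= `|b| & B <= `|B|].
  by split; rewrite ?ler_norm // lerNl -normrN ler_norm.
have [na nb nB] : [/\ 0 <= `|a|, 0 <= `|b| & 0 <= `|B|] by [].
have q_le0 c x : x <= c -> (x - c) / L <= 0.
  by move=> xc; rewrite ler_pdivrMr // mul0r subr_le0.
have q_ge1 c x : c + L <= x -> 1 <= (x - c) / L.
  by move=> xc; rewrite ler_pdivlMr // mul1r lerBrDl.
(* [S c] is the step across the interval of length [L] starting at [c]. *)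
pose S c (x : R) := smooth_step ((x - c) / L).
have SE c : S c = (fun x => smooth_step (L^-1 * x + (- c / L))).
  by apply/funext => x; rewrite /S; congr smooth_step; ring.
have sS c : smooth_closure (S c).
  by rewrite SE; exact: SC_affine smooth_closure_step.
pose s c (x : R) := L^-1 * 'D_1 smooth_step ((x - c) / L).
have ss c : smooth_closure (s c).
  apply: SC_mul; first exact: SC_cst.
  rewrite (_ : (fun x => _) = (fun x => 'D_1 smooth_step (L^-1 * x + (- c / L)))).
    exact: SC_affine smooth_closure_derive_step.
  by apply/funext => x; congr ('D_1 smooth_step _); ring.
have dS c (x : R) : is_derive x 1 (S c) (s c x).
  rewrite SE; have d1 := is_derive_affine L^-1 (- c / L) x.
  have d2 : is_derive (L^-1 * x + (- c / L)) 1 smooth_step ('D_1 smooth_step ((x - c) / L)).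
    rewrite (_ : (x - c) / L = L^-1 * x + (- c / L)); last by ring.
    exact/derivableP/smooth_closure_derivable/smooth_closure_step.
  have d3 := @is_derive1_comp _ smooth_step (fun y => L^-1 * y + (- c / L)) x _ _ d2 d1.
  by apply: (is_derive_eq d3); rewrite /s mulrC.
have s_ge0 c x : 0 <= s c x.
  by rewrite mulr_ge0 ?derive_smooth_step_ge0 // invr_ge0 ltW.
have s_out c x : ~~ (c < x < c + L) -> s c x = 0.
  move=> xN; rewrite /s derive_smooth_step_out ?mulr0 //.
  by move: xN; rewrite ltr_pdivlMr // ltr_pdivrMr // mul0r mul1r subr_gt0 ltrBlDl.
pose phi (x : R) := 2 * S a x + -1 * (S x1 x + S x3 x).
have sphi : smooth_closure phi.
  apply: SC_add; apply: SC_mul; try exact: SC_cst; first exact: sS.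
  by apply: SC_add; exact: sS.
have dphi (x : R) : 'D_1 phi x = 2 * s a x - (s x1 x + s x3 x).
  have d1 := is_deriveZ 2 (dS a x).
  have d2 := is_deriveZ (-1) (is_deriveD (dS x1 x) (dS x3 x)).
  have [_ ->] : is_derive x 1 phi _ := is_deriveD d1 d2.
  by rewrite /GRing.scale /= mulN1r.
have gphi x : g x * phi^`()%classic x = 2 * (g x * s a x).
  rewrite derive1E dphi.
  have [xB|xB] := ltrP B `|x|; first by rewrite gB // !mul0r mulr0.
  move: xB; rewrite ler_norml => /andP[xB1 xB2].
  rewrite (s_out x1); last by rewrite negb_and -!leNgt /x1 /x3; apply/orP; right; lra.
  rewrite (s_out x3); last by rewrite negb_and -!leNgt /x3; apply/orP; left; lra.
  by rewrite addr0 subr0; ring.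
have phi_supp x : phi x != 0 -> x \in `[x1, x3 + L].
  apply: contraNT; rewrite in_itv /= negb_and -!ltNge => /orP[xl|xl].
  - rewrite /phi /S !smooth_step_le0; last 3 first.
    + by apply: q_le0; move: xl; rewrite /x1 /x3; lra.
    + by apply: q_le0; move: xl; rewrite /x1 /x3; lra.
    + by apply: q_le0; move: xl; rewrite /x1 /x3; lra.
    by apply/eqP; ring.
  - rewrite /phi /S !smooth_step_ge1; last 3 first.
    + by apply: q_ge1; move: xl; rewrite /x1 /x3 /L; lra.
    + by apply: q_ge1; move: xl; rewrite /x1 /x3 /L; lra.
    + by apply: q_ge1; move: xl; rewrite /x1 /x3 /L; lra.
    by apply/eqP; ring.
apply: (@le_trans _ _ (\int[mu]_x (g x * phi^`()%classic x)%:E)%E); last first.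
  apply: ereal_sup_ubound; exists phi; split => //.
  - split; first exact: smooth_closure_smooth.
    apply: (@subclosed_compact _ (closure [set x | phi x != 0]) `[x1, x3 + L]%classic).
    - exact: closed_closure.
    - exact: segment_compact.
    have cI : closed (`[x1, x3 + L]%classic : set R) by exact: itv_closed.
    have -> : `[x1, x3 + L]%classic = closure (`[x1, x3 + L]%classic : set R).
      exact/closure_id.
    by apply: closure_subset => x /= /phi_supp.
  - move=> x; rewrite /phi.
    have := smooth_step_01 ((x - a) / L); have := smooth_step_01 ((x - x1) / L).
    have := smooth_step_01 ((x - x3) / L).
    rewrite -/(S a x) -/(S x1 x) -/(S x3 x) => /andP[? ?] /andP[? ?] /andP[? ?].
    have [xa|xa] := lerP x a.
      have -> : S a x = 0 by rewrite /S smooth_step_le0 // q_le0.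
      have -> : S x3 x = 0.
        by rewrite /S smooth_step_le0 // q_le0 // /x3; lra.
      by rewrite ler_norml; apply/andP; split; lra.
    have -> : S x1 x = 1.
      by rewrite /S smooth_step_ge1 // q_ge1 // /x1 /x3; lra.
    have [xb|xb] := lerP x b.
      have -> : S x3 x = 0.
        by rewrite /S smooth_step_le0 // q_le0 // /x3; lra.
      by rewrite ler_norml; apply/andP; split; lra.
    have -> : S a x = 1.
      by rewrite /S smooth_step_ge1 // q_ge1 // /L; lra.
    by rewrite ler_norml; apply/andP; split; lra.
under eq_integral do rewrite gphi.
have ms : measurable_fun [set: measurableTypeR R] (s a : measurableTypeR R -> R).
  by apply: continuous_measurable_fun; apply: smooth_closure_continuous; exact: ss.
pose h (x : measurableTypeR R) := (2 * (g x * s a x))%:E.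
have mh : measurable_fun [set: measurableTypeR R] h.
  by apply/measurable_EFinP; apply: measurable_funM; [exact: measurable_cst|exact: measurable_funM].
have h0 x : (0 <= h x)%E by rewrite /h lee_fin mulr_ge0 // mulr_ge0.
have mI : measurable (`[a, b]%classic : set (measurableTypeR R)) by exact: measurable_itv.
apply: (@le_trans _ _ (\int[mu]_(x in `[a, b]) h x)%E); last first.
  by apply: ge0_subset_integral => //.
apply: (@le_trans _ _ (\int[mu]_(x in `[a, b]) (2 * m * s a x)%:E)%E).
  have sf : smooth_closure (fun x => cst (2 * m) x * s a x).
    by apply: SC_mul; [exact: SC_cst|exact: ss].
  have sF : smooth_closure (fun x => cst (2 * m) x * S a x).
    by apply: SC_mul; [exact: SC_cst|exact: sS].
  have dF (x : R) : is_derive x 1 (fun x => cst (2 * m) x * S a x) (cst (2 * m) x * s a x).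
    exact: (is_deriveZ (2 * m) (dS a x)).
  rewrite (integral_smooth_closure ab sf sF dF) /= /S subrr mul0r.
  rewrite (smooth_step_le0 (lexx 0)) -/L divff // (smooth_step_ge1 (lexx 1)).
  by rewrite mulr0 mulr1 sube0.
apply: ge0_le_integral => //.
- by move=> x _; rewrite lee_fin mulr_ge0 // mulr_ge0.
- apply/measurable_EFinP; apply: measurable_funM => //; exact: measurable_funTS.
- exact: measurable_funTS.
- move=> x; rewrite /= in_itv /= => xab; rewrite /h lee_fin -mulrA ler_pM2l //.
  by rewrite ler_wpM2r // gm.
Qed.
End SmoothStep.

(** * The Radon transform along one direction *)

Section RadonLowerBound.
Context {R : realType}.
Local Notation mu := (@lebesgue_measure R).
Local Notation mu2 := (@lebesgue2 R).

Lemma enorm_le_norm (x : R * R) : enorm x <= 2 * `|x|.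
Proof.
have x0 := normr_ge0 x.
rewrite -[leRHS]ger0_norm ?mulr_ge0 // -sqrtr_sqr; apply: ler_wsqrtr.
have [x1 x2] : `|x.1| <= `|x| /\ `|x.2| <= `|x| by rewrite prod_normE !le_max !lexx orbT.
have s1 : x.1 ^+ 2 <= `|x| ^+ 2 by rewrite -(real_normK (num_real x.1)) ler_sqr ?nnegrE.
have s2 : x.2 ^+ 2 <= `|x| ^+ 2 by rewrite -(real_normK (num_real x.2)) ler_sqr ?nnegrE.
have := sqr_ge0 `|x|; rewrite exprMn; lra.
Qed.

Lemma Rintegral_indic_itv (c a b : R) : a <= b ->
  \int[mu]_t (c * \1_(`[a, b]%classic) t) = c * (b - a).
Proof.
move=> ab; rewrite RintegralZl //; last exact: (integrable_indic_itv a b true false).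
congr (_ * _); pose I : set (measurableTypeR R) := `[a, b]%classic.
have mI : measurable I by exact: measurable_itv.
transitivity (fine (mu I)).
  by rewrite /Rintegral integral_indic // setIT.
rewrite /I lebesgue_measure_itv /= lte_fin.
by case: ltgtP ab => // ab' _; rewrite /= ab' subrr.
Qed.

Variables (f : R * R -> R) (theta : R * R) (F M : R).
Hypotheses (mf : measurable_fun [set: plane R] (f : plane R -> R)).
Hypotheses (f0 : forall x, 0 <= f x) (fF : forall x, f x <= F).
Hypotheses (fM : forall x, M < `|x| -> f x = 0) (theta1 : enorm theta = 1).

(* The line of integration; a point of it is at distance [|(s, t)|] from 0. *)
Let line (s t : R) : R * R := (s * theta.1 - t * theta.2, s * theta.2 + t * theta.1).

Let theta2 : theta.1 ^+ 2 + theta.2 ^+ 2 = 1.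
Proof. by rewrite -sqr_enorm theta1 expr1n. Qed.

Let enorm_line s t : enorm (line s t) ^+ 2 = s ^+ 2 + t ^+ 2.
Proof.
rewrite sqr_enorm /line /=.
rewrite (_ : _ + _ = (s ^+ 2 + t ^+ 2) * (theta.1 ^+ 2 + theta.2 ^+ 2)); last by ring.
by rewrite theta2 mulr1.
Qed.

Let line_far s t : 2 * M < `|s| \/ 2 * M < `|t| -> f (line s t) = 0.
Proof.
move=> st; apply: fM; rewrite ltNge; apply/negP => lM.
have : enorm (line s t) <= 2 * M.
  by apply: le_trans (enorm_le_norm _) _; rewrite ler_pM2l.
have [sl tl] : `|s| <= enorm (line s t) /\ `|t| <= enorm (line s t).
  by split; rewrite -ler_sqr ?nnegrE ?enorm_ge0 // enorm_line real_normK ?num_real //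
    ?lerDl ?lerDr sqr_ge0.
by case: st; lra.
Qed.

Let mline : measurable_fun [set: plane R] (fun z : plane R => f (line z.1 z.2)).
Proof.
apply: (measurableT_comp mf).
apply: measurable_fun_pair.
- apply: measurable_funB; apply: measurable_funM => //; exact: measurable_fst || exact: measurable_snd.
- apply: measurable_funD; apply: measurable_funM => //; exact: measurable_fst || exact: measurable_snd.
Qed.

Let mline1 s : measurable_fun [set: measurableTypeR R] (fun t : measurableTypeR R => f (line s t)).
Proof. exact: (measurableT_comp mline (pair1_measurable s)). Qed.

(** Tonelli's theorem, after the rotation of the plane that maps [(s, t)] to
    [line s t]. *)
Lemma measurable_radon :
  measurable_fun [set: measurableTypeR R] (fun s : measurableTypeR R => radon f s theta).
Proof.
have mE : measurable_fun [set: plane R] (fun z : plane R => (f (line z.1 z.2))%:E).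
  exact/measurable_EFinP.
have mG := measurable_fun_fubini_tonelli_F (m2 := mu)
  (fun z : plane R => (f (line z.1 z.2))%:E) mE (fun z => f0 _).
exact: (measurableT_comp (@fine_measurable R setT measurableT) mG).
Qed.

Lemma radon_ge0 s : 0 <= radon f s theta.
Proof. by apply: Rintegral_ge0. Qed.

Lemma radon_far s : 2 * M < `|s| -> radon f s theta = 0.
Proof.
move=> sM; rewrite /radon (@eq_Rintegral _ _ _ mu _ (cst 0)); last first.
  by move=> t _; apply: line_far; left.
by rewrite Rintegral_cst // mul0r.
Qed.

Let integrable_line s : mu.-integrable setT (EFin \o (fun t => f (line s t))).
Proof.
pose I : set (measurableTypeR R) := `[- (2 * M), 2 * M]%classic.
have mI : measurable I by exact: measurable_itv.
have muI : (mu I < +oo)%E.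
  by rewrite /I lebesgue_measure_itv /=; case: ifP => _; rewrite -?EFinD ltry.
pose g (t : measurableTypeR R) : \bar R := (f (line s t))%:E.
have gI : g = g \_ I.
  apply/funext => t; rewrite patchE; case: ifPn => // tI /=.
  rewrite /g line_far //; right; rewrite ltNge; apply: contra tI.
  by rewrite ler_norml inE /I /= in_itv.
have H := integrable_mkcond (mu := mu) g mI.
suff : mu.-integrable I g by move=> /H; rewrite -gI.
apply: measurable_bounded_integrable => //.
- exact: measurable_funTS.
- exists F; split; first exact: num_real.
  by move=> B FB t _; rewrite /= ger0_norm // (le_trans (fF _)) // ltW.
Qed.

Lemma radon_ge s (al t0 len : R) : 0 <= len ->
  (forall t, t0 <= t <= t0 + len -> al <= f (line s t)) ->
  al * len <= radon f s theta.
Proof.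
move=> len0 fal.
rewrite (_ : al * len = al * (t0 + len - t0)); last by ring.
rewrite -Rintegral_indic_itv; last by rewrite lerDl.
apply: le_Rintegral => //.
- exact: (integrableZl measurableT al (integrable_indic_itv t0 (t0 + len) true false)).
- exact: integrable_line.
move=> t _; rewrite indicE; case: (boolP (_ \in _)); last by rewrite mulr0.
by rewrite inE /= in_itv /= mulr1 => /fal.
Qed.
End RadonLowerBound.

(** * The diameter of a level set *)

Section RTVLowerBound.
Context {R : realType}.
Local Notation mu2 := (@lebesgue2 R).

(** A bounded set contained in a line has area 0, by [slice_bound] along that
    line. *)
Lemma exists_off_line (K : set (plane R)) (theta : R * R) (s M : R) :
  measurable K -> (forall x : R * R, K x -> `|x| <= M) -> enorm theta = 1 ->
  (0 < mu2 K)%E -> exists2 z, K z & dot z theta != s.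
Proof.
move=> mK KM theta1 K0; apply: contrapT => noz.
have Kline z : K z -> dot z theta = s.
  by move=> Kz; apply: contrapT => /eqP zs; apply: noz; exists z.
have M0 : 0 <= `|M| by [].
suff : (mu2 K <= (4 * `|M| * 0)%:E)%E by rewrite mulr0 leNgt K0.
apply: (@slice_bound _ K (- theta.2, theta.1) (4 * `|M|) 0 (- s)) => //.
- by rewrite -theta1 /enorm /= sqrrN addrC.
- move=> z /Kline <-; rewrite /dot /= addr0; apply/andP; split; lra.
- move=> z; apply: narrow_interval; first by rewrite mulr_ge0.
  move=> t t' /KM zt /KM zt'.
  pose w : R * R := (- theta.2, theta.1).
  have -> : t' - t = dot ((t' - t) *: w) w.
    rewrite /dot /= /GRing.scale /=.
    rewrite (_ : _ + _ = (t' - t) * (theta.1 ^+ 2 + theta.2 ^+ 2)); last by ring.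
    by rewrite -sqr_enorm theta1 expr1n mulr1.
  apply: le_trans (dot_le_enorm _ _) _.
  have -> : enorm w = 1 by rewrite -theta1 /enorm /= sqrrN addrC.
  rewrite mulr1; apply: le_trans (enorm_le_norm _) _.
  have : `|(t' - t) *: w| <= M + M.
    rewrite (_ : (t' - t) *: w = (z.1 + t' * - theta.2, z.2 + t' * theta.1) -
      (z.1 + t * - theta.2, z.2 + t * theta.1)).
      by apply: le_trans (ler_normB _ _) _; exact: lerD.
    by rewrite /w; congr pair; rewrite /= /GRing.scale /=; ring.
  have := ler_norm M; lra.
Qed.

Lemma le_of_scaled_le (c r : R) : 0 <= c ->
  (forall e, 0 < e -> e < 1 -> c * (1 - e) <= r) -> c <= r.
Proof.
move=> c0 H; have h2 := H (1/2) ltac:(lra) ltac:(lra).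
have [//|rc] := lerP c r.
have cp : 0 < c by lra.
pose e := (c - r) / (2 * c).
have e0 : 0 < e by rewrite divr_gt0 ?mulr_gt0 ?subr_gt0.
have e1 : e < 1 by rewrite ltr_pdivrMr ?mulr_gt0 //; lra.
have := H e e0 e1.
have -> : c * (1 - e) = (c + r) / 2 by rewrite /e; field; rewrite gt_eqF.
lra.
Qed.

Variables (f : R * R -> R) (F M : R).
Hypotheses (mf : measurable_fun [set: plane R] (f : plane R -> R)).
Hypotheses (f0 : forall x, 0 <= f x) (fF : forall x, f x <= F).
Hypotheses (fM : forall x : R * R, M < `|x| -> f x = 0).

Lemma RTV_ge_itv (theta : R * R) (a b m : R) : enorm theta = 1 -> a < b -> 0 <= m ->
  (forall s, a <= s <= b -> m <= radon f s theta) ->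
  ((2 * m)%:E <= RTV (radon f))%E.
Proof.
move=> theta1 ab m0 H.
apply: (@le_trans _ _ (TV1 (radon f ^~ theta))).
  apply: (@TV1_ge _ _ (2 * M) a b) => //.
  - exact: measurable_radon.
  - by move=> s; exact: radon_ge0.
  - by move=> s sM; apply: (@radon_far _ _ _ M).
by apply: ereal_sup_ubound; exists theta.
Qed.

Lemma RTV_radon_ge0 : (0 <= RTV (radon f))%E.
Proof.
have e1 : enorm ((1, 0) : R * R) = 1.
  by rewrite /enorm /= expr1n expr0n /= addr0 sqrtr1.
have := @RTV_ge_itv (1, 0) 0 1 0 e1 ltr01 (lexx 0).
by rewrite mulr0; apply => s _; exact: radon_ge0.
Qed.

(** The lines at height [s0 + lam * tau] meet the triangle [pqz] in a segment
    of length [(1 - lam) * d] parallel to [pq], where [d] is the length of [pq]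
    and [tau] the signed height of [z] above [pq]. *)
Lemma RTV_radon_ge (K : set (plane R)) (al : R) (p q : R * R) :
  measurable K -> convex_set (K : set (R * R)) -> (0 < mu2 K)%E ->
  (forall x : R * R, K x -> `|x| <= M) -> 0 <= al -> (forall x, K x -> al <= f x) ->
  K p -> K q -> ((2 * al * enorm (q - p))%:E <= RTV (radon f))%E.
Proof.
move=> mK cK K0 KM al0 fal Kp Kq.
have [d0|dN0] := eqVneq (enorm (q - p)) 0; first by rewrite d0 mulr0 RTV_radon_ge0.
set d := enorm (q - p) in dN0 *.
have d_gt0 : 0 < d by rewrite lt_def dN0 enorm_ge0.
have [theta [th1 th2]] : exists theta : R * R,
    theta.1 = (q.2 - p.2) / d /\ theta.2 = (p.1 - q.1) / d.
  by exists ((q.2 - p.2) / d, (p.1 - q.1) / d).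
have dE : (q.1 - p.1) ^+ 2 + (q.2 - p.2) ^+ 2 = d ^+ 2 by rewrite sqr_enorm.
have theta1 : enorm theta = 1.
  rewrite /enorm th1 th2 !expr_div_n -mulrDl (_ : _ + _ = d ^+ 2); last by rewrite -dE; ring.
  by rewrite divff ?sqrtr1 // expf_neq0.
have theta2 : theta.1 ^+ 2 + theta.2 ^+ 2 = 1 by rewrite -sqr_enorm theta1 expr1n.
pose s0 := dot p theta.
have [z Kz zs] := @exists_off_line K theta s0 M mK KM theta1 K0.
pose tau := dot z theta - s0.
have tauN0 : tau != 0 by rewrite subr_eq0.
(* [c] is the point of the side [pz] at that height, and [t0] its abscissa on
   the line of integration. *)
have radon_lam lam : 0 <= lam -> lam < 1 -> al * ((1 - lam) * d) <= radon f (s0 + lam * tau) theta.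
  move=> l0 l1.
  have l1' : 0 < 1 - lam by rewrite subr_gt0.
  have [c [c1 c2]] : exists c : R * R,
      c.1 = (1 - lam) * p.1 + lam * z.1 /\ c.2 = (1 - lam) * p.2 + lam * z.2.
    by exists ((1 - lam) * p.1 + lam * z.1, (1 - lam) * p.2 + lam * z.2).
  pose t0 := - c.1 * theta.2 + c.2 * theta.1.
  apply: (@radon_ge _ f theta F M mf f0 fF fM theta1 _ _ t0).
    by rewrite mulr_ge0 ?ltW.
  move=> t /andP[tl tu]; apply: fal.
  have [r r01 tE] : exists2 r, 0 <= r <= 1 & t = t0 + r * ((1 - lam) * d).
    have den : 0 < (1 - lam) * d by rewrite mulr_gt0.
    exists ((t - t0) / ((1 - lam) * d)); last by rewrite divfK ?subrKC // gt_eqF.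
    rewrite divr_ge0 ?subr_ge0 ?(ltW den) //=.
    by rewrite ler_pdivrMr // mul1r; lra.
  have Ky := convex_set_segment cK Kq Kp r01.
  have l01 : 0 <= 1 - lam <= 1 by apply/andP; split; lra.
  have := convex_set_segment cK Ky Kz l01.
  have sE : s0 + lam * tau = dot c theta by rewrite /tau /s0 /dot c1 c2; ring.
  congr K; rewrite sE tE /dot /t0; congr pair => /=.
  - transitivity (c.1 * (theta.1 ^+ 2 + theta.2 ^+ 2) - (1 - lam) * r * (d * theta.2)); last by ring.
    by rewrite theta2 c1 th2; field.
  - transitivity (c.2 * (theta.1 ^+ 2 + theta.2 ^+ 2) + (1 - lam) * r * (d * theta.1)); last by ring.
    by rewrite theta2 c2 th1; field.
have RTVe e : 0 < e -> e < 1 -> ((2 * (al * ((1 - e) * d)))%:E <= RTV (radon f))%E.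
  move=> e0 e1.
  have m0 : 0 <= al * ((1 - e) * d).
    by rewrite mulr_ge0 // mulr_ge0 ?(ltW d_gt0) // subr_ge0 ltW.
  have lamP s lam : s = s0 + lam * tau -> 0 <= lam <= e -> al * ((1 - e) * d) <= radon f s theta.
    move=> -> /andP[l0 le]; apply: le_trans (radon_lam lam l0 _); last by apply: le_lt_trans le e1.
    by rewrite ler_wpM2l // ler_wpM2r ?(ltW d_gt0) // lerD2l lerN2.
  have sE s : s = s0 + (s - s0) / tau * tau by rewrite divfK // addrC subrK.
  have [tau_gt0|tau_le0] := ltrP 0 tau.
    apply: (@RTV_ge_itv theta s0 (s0 + e * tau)) => //.
      by rewrite ltrDl mulr_gt0.
    move=> s /andP[sl su]; apply: lamP (sE s) _.
    apply/andP; split; last by rewrite ler_pdivrMr // lerBlDl.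
    by apply: divr_ge0 (ltW tau_gt0); rewrite subr_ge0.
  have tau_lt0 : tau < 0 by rewrite lt_neqAle tauN0.
  apply: (@RTV_ge_itv theta (s0 + e * tau) s0) => //.
    by rewrite gtrDl pmulr_rlt0.
  move=> s /andP[sl su]; apply: lamP (sE s) _.
  rewrite ler_ndivrMr // lerBrDl sl andbT.
  rewrite -mulrNN -invrN; apply: divr_ge0; first by rewrite oppr_ge0 subr_le0.
  by rewrite oppr_ge0 ltW.
have := RTV_radon_ge0; case: (RTV (radon f)) RTVe => [r RTVe _|_ _|//]; last by rewrite leey.
rewrite lee_fin; apply: le_of_scaled_le.
  by rewrite mulr_ge0 ?mulr_ge0 // ltW.
move=> e e0 e1; have := RTVe e e0 e1; rewrite lee_fin; apply: le_trans.
by rewrite le_eqVlt; apply/orP; left; apply/eqP; ring.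
Qed.
End RTVLowerBound.

(** * Layers and conclusion *)

Section LayerCake.
Context {R : realType}.

(** The increments of the sequence made of 0 followed by [a]. *)
Definition jump (a : nat -> R) (k : nat) : R := if k is k'.+1 then a k - a k' else a 0%N.

Lemma sum_jump (a : nat -> R) m : \sum_(0 <= k < m.+1) jump a k = a m.
Proof.
elim: m => [|m IH]; first by rewrite big_nat1.
by rewrite big_nat_recr //= IH addrC subrK.
Qed.

Lemma jump_ge0 (a : nat -> R) n k : (forall j, (j < n)%N -> 0 < a j) ->
  (forall i j, (i < j)%N -> (j < n)%N -> a i < a j) ->
  (k < n)%N -> 0 <= jump a k <= a k.
Proof.
case: k => [|k] a0 aincr kn /=; first by rewrite lexx andbT ltW // a0.
rewrite subr_ge0 (ltW (aincr _ _ (ltnSn k) kn)) /= gerBl ltW // a0 //.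
exact: ltn_trans (ltnSn k) kn.
Qed.

Lemma layer_cake (a : nat -> R) n (y : R) :
  (forall j, (j < n)%N -> 0 < a j) ->
  (forall i j, (i < j)%N -> (j < n)%N -> a i < a j) ->
  y = 0 \/ (exists2 i, (i < n)%N & y = a i) ->
  y = \sum_(0 <= k < n) jump a k * (a k <= y)%R%:R.
Proof.
move=> a0 aincr [->|[i iN ->]].
  rewrite big_nat big1 // => k /andP[_ kn].
  by rewrite leNgt a0 // mulr0.
rewrite (@big_cat_nat _ _ _ i.+1) //= [X in _ = _ + X]big_nat [X in _ = _ + X]big1 ?addr0.
  rewrite -{1}[a i]sum_jump; apply: eq_big_nat => k /andP[_ ki].
  suff -> : a k <= a i by rewrite mulr1.
  by move: ki; rewrite ltnS leq_eqVlt => /orP[/eqP ->//|ki]; rewrite ltW // aincr.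
by move=> k /andP[ik kn]; rewrite leNgt aincr // mulr0.
Qed.
End LayerCake.

Theorem corollary1 (R : realType) (N : nat) (hN : (1 <= N)%N)
    (f : R * R -> R) (alpha : 'I_N -> R)
    (f_ge0 : forall x, 0 <= f x)
    (alpha_gt0 : forall i, 0 < alpha i)
    (alpha_incr : forall i j : 'I_N, (i < j)%N -> alpha i < alpha j)
    (f_values : range f `\ 0 = range alpha)
    (level_closed : forall i, closed (upper_level f (alpha i)))
    (level_convex : forall i, convex_set (upper_level f (alpha i)))
    (level_bounded : forall i, bounded_set (upper_level f (alpha i)))
    (level_pos : forall i, (0 < lebesgue2 (upper_level f (alpha i)))%E) :
  ((2 / (pi * N%:R))%:E * TV2 f <= RTV (radon f))%E.
Proof.
case: N hN alpha alpha_gt0 alpha_incr f_values level_closed level_convex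
  level_bounded level_pos => // n _ alpha alpha_gt0 alpha_incr f_values
  level_closed level_convex level_bounded level_pos.
pose a (k : nat) : R := alpha (inord k).
pose K (k : nat) : set (plane R) := upper_level f (a k).
have a_gt0 j : 0 < a j by exact: alpha_gt0.
have a_incr i j : (i < j)%N -> (j < n.+1)%N -> a i < a j.
  by move=> ij jn; apply: alpha_incr; rewrite !inordK // (ltn_trans ij).
have f_val x : f x = 0 \/ exists2 i, (i < n.+1)%N & f x = a i.
  have [->|/eqP fN0] := eqVneq (f x) 0; first by left.
  right; have [i _ iE] : range alpha (f x) by rewrite -f_values; split => //; exists x.
  by exists i => //; rewrite /a inord_val.
have mK k : measurable (K k) by apply: closed_measurable_plane; exact: level_closed.
have [M KM] : exists M, forall x : R * R, M < `|x| -> f x = 0.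
  have [M [_ HM]] := level_bounded ord0.
  exists (M + 1) => x xM; have [//|[i iN fE]] := f_val x.
  suff : `|x| <= M + 1 by rewrite leNgt xM.
  apply: HM; first by rewrite ltrDl.
  rewrite /upper_level /= fE (_ : ord0 = inord 0) -/(a 0%N); last first.
    by apply: val_inj; rewrite /= inordK.
  by case: i iN {fE} => // i iN; rewrite ltW // a_incr.
have KkM k (x : R * R) : K k x -> `|x| <= M.
  move=> Kx; rewrite leNgt; apply/negP => /KM fx.
  by move: Kx; rewrite /K /upper_level /= fx leNgt a_gt0.
have fE (x : R * R) : f x = \sum_(0 <= k < n.+1) jump a k * \1_(K k) x.
  rewrite {1}(@layer_cake _ a n.+1 (f x)) //.
  apply: eq_bigr => k _; rewrite indicE; congr (_ * (_ : bool)%:R).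
  by apply/idP/idP; rewrite inE.
have mf : measurable_fun [set: plane R] (f : plane R -> R).
  have -> : f = (fun x : R * R => \sum_(0 <= k < n.+1) jump a k * \1_(K k) x) by exact/funext.
  elim: n.+1 => [|m IH].
    by under eq_fun do rewrite big_geq //; exact: measurable_cst.
  under eq_fun do rewrite big_nat_recr //=.
  apply: measurable_funD => //; apply: measurable_funM; first exact: measurable_cst.
  exact: measurable_indic.
have fF x : f x <= a n.
  have [->|[i iN ->]] := f_val x; first exact: ltW.
  by move: iN; rewrite ltnS leq_eqVlt => /orP[/eqP ->//|iN]; rewrite ltW // a_incr.
have := @RTV_radon_ge0 R f M mf f_ge0 KM.
have lower k p q : K k p -> K k q -> ((2 * a k * enorm (q - p))%:E <= RTV (radon f))%E.
  move=> Kp Kq; apply: (@RTV_radon_ge R f (a n) M mf f_ge0 fF KM (K k)) => //.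
  - exact: level_convex.
  - exact: level_pos.
  - exact: KkM.
  - exact: ltW.
(* The diameter of [K k] is thus at most [r / (2 * a k)]. *)
case: (RTV (radon f)) lower => [r lower|_ _|//]; last by rewrite leey.
rewrite lee_fin => r0.
have N0 : 0 < n.+1%:R :> R by rewrite ltr0n.
have pi0 := pi_gt0 R.
apply: (@le_trans _ _ ((2 / (pi * n.+1%:R))%:E * (n.+1%:R * (pi * r / 2))%:E)%E); last first.
  rewrite -EFinM lee_fin le_eqVlt; apply/orP; left; apply/eqP.
  by move: n.+1%:R (@pi R) N0 pi0 => z w z0 w0; field; rewrite !gt_eqF.
apply: lee_wpmul2l; first by rewrite lee_fin divr_ge0 // mulr_ge0 // ltW.
apply: ge_ereal_sup => _ [phi [t1 t2 phi1 ->]].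
have C1 := test_function_C1 t1; have C2 := test_function_C1 t2.
have idiv k := integrable_indic_divergence (mK k) (KkM k) C1 C2.
pose G k (x : plane R) := jump a k * (\1_(K k) x * divergence phi x).
have iG k : lebesgue2.-integrable [set: plane R] (EFin \o G k).
  exact: integrableZ_real.
have -> : (\int[lebesgue2]_x (f x * divergence phi x)%:E =
    (\int[lebesgue2]_x (\sum_(0 <= k < n.+1) G k x))%:E)%E.
  rewrite /Rintegral fineK; last first.
    by apply: integrable_fin_num => //; exact: (integrable_sum_real _ iG).
  apply: eq_integral => x _; congr EFin.
  by rewrite fE mulr_suml; apply: eq_bigr => k _; rewrite /G mulrA.
rewrite lee_fin Rintegral_sum // mulr_natl -[in leRHS](subn0 n.+1) -sumr_const_nat.
rewrite big_nat [leRHS]big_nat; apply: ler_sum => k /andP[_ kn].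
rewrite RintegralZl //.
have /andP[j0 ja] := jump_ge0 (fun j _ => a_gt0 j) a_incr kn.
have D0 : 0 <= r / (2 * a k) by rewrite divr_ge0 // mulr_ge0 // ltW.
have KD (p q : R * R) : K k p -> K k q -> enorm (p - q) <= r / (2 * a k).
  move=> Kp Kq; have := lower k q p Kq Kp; rewrite lee_fin => H.
  by rewrite ler_pdivlMr ?mulr_gt0 // mulrC.
have := convex_divergence_bound (mK k) (level_convex _) D0 (KkM k) KD C1 C2 phi1.
move=> /(ler_wpM2l j0) H; apply: le_trans H _.
apply: (@le_trans _ _ (a k * (pi * (r / (2 * a k))))).
  by rewrite ler_wpM2r // mulr_ge0 // ltW.
by rewrite le_eqVlt; apply/orP; left; apply/eqP; field; rewrite gt_eqF.
Qed.
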